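(* Let $k$ be an algebraically closed field of characteristic $0$, let $G$ be a finite group, and let $\mathcal{C}=\bigoplus_{g\in G}\mathcal{C}_g$ be an integral $G$-graded fusion category over $k$ with associativity constraint $\alpha_{X,Y,Z}:(X\otimes Y)\otimes Z\to X\otimes(Y\otimes Z)$. Let $D=\mathrm{FPdim}(\mathcal{C}_e)$ and let $R_g=\bigoplus_{X\in\mathcal{O}(\mathcal{C}_g)}d(X)\,X$ be the regular object of $\mathcal{C}_g$, $g\in G$. Then the function $$\alpha^{\mathcal{C}}(f,g,h)=\det(\alpha_{R_f,R_g,R_h})^D,\qquad f,g,h\in G,$$ is a $3$-cocycle on $G$ with values in $k^\times$. Its class in $H^3(G,k^\times)$ is an invariant of the $G$-graded fusion category $\mathcal{C}$; that is, if $\mathcal{C}'$ is a $G$-graded fusion category equivalent to $\mathcal{C}$ by a grading preserving tensor equivalence, then $\alpha^{\mathcal{C}}$ and $\alpha^{\mathcal{C}'}$ are cohomologous.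
   Context: A fusion category is integral if all Frobenius-Perron dimensions of its objects are integers. A $G$-grading of $\mathcal{C}$ is a map $\deg$ from the set $\mathcal{O}(\mathcal{C})$ of isomorphism classes of simple objects to $G$ such that $\deg(X)\deg(Y)=\deg(Z)$ whenever the simple object $Z$ is contained in $X\otimes Y$; then $\mathcal{C}=\bigoplus_{g\in G}\mathcal{C}_g$, where $\mathcal{C}_g$ is the full additive subcategory generated by the simple objects of degree $g$. $d(X)$ denotes the Frobenius-Perron dimension of $X$, and $\mathcal{O}(\mathcal{C}_g)$ the set of isomorphism classes of simple objects of $\mathcal{C}_g$. $G$ acts trivially on $k^\times$. For an automorphism $\phi:X\to X$ in an integral fusion category $\mathcal{C}$, its determinant is $$\det(\phi)=\prod_{Z\in\mathcal{O}(\mathcal{C})}\det\bigl(\phi|_{\mathrm{Hom}_{\mathcal{C}}(Z,X)}\bigr)^{d(Z)}\in k^\times .$$ The setup uses the identities $d(R_g)=D$ and $R_f\otimes R_g=D\,R_{fg}$ (direct sum of $D$ copies) and the convention that the abelian subcategory generated by the objects $R_g$, $g\in G$, is skeletal, i.e., isomorphic objects in it are equal; in this way the isomorphism $\alpha_{R_f,R_g,R_h}:(R_f\otimes R_g)\otimes R_h\to R_f\otimes(R_g\otimes R_h)$ is identified with an automorphism of $D^2R_{fgh}$ and its determinant is defined. *)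

(* Defs.v *)
From HB Require Import structures.
From mathcomp Require Import all_boot all_order all_algebra all_fingroup all_field.

Set Implicit Arguments.
Unset Strict Implicit.
Unset Printing Implicit Defensive.

Import Order.TTheory GRing.Theory Num.Theory.
Local Open Scope ring_scope.

Record linCat (k : fieldType) := LinCat {
  obj :> Type;
  hom : obj -> obj -> vectType k;
  idm : forall X : obj, hom X X;
  comp : forall X Y Z : obj, hom Y Z -> hom X Y -> hom X Z;
  comp_idl : forall (X Y : obj) (f : hom X Y), comp (idm Y) f = f;
  comp_idr : forall (X Y : obj) (f : hom X Y), comp f (idm X) = f;
  comp_assoc : forall (X Y Z W : obj) (h : hom Z W) (g : hom Y Z) (f : hom X Y),
    comp h (comp g f) = comp (comp h g) f;
  comp_linl : forall (X Y Z : obj) (f : hom X Y),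
    linear (fun g : hom Y Z => comp g f);
  comp_linr : forall (X Y Z : obj) (g : hom Y Z),
    linear (fun f : hom X Y => comp g f) }.

Arguments hom {k l} X Y.
Arguments idm {k l} X.
Arguments comp {k l X Y Z} g f.

Notation "g \co f" := (comp g f) (at level 40, left associativity).

Record iso (k : fieldType) (C : linCat k) (X Y : C) := Iso {
  fwd :> hom X Y;
  bwd : hom Y X;
  bwdK : bwd \co fwd = idm X;
  fwdK : fwd \co bwd = idm Y }.

Definition hom_of_eq (k : fieldType) (C : linCat k) (X Y : C) (e : X = Y) :
    hom X Y :=
  match e in _ = Y' return hom X Y' with erefl => idm X end.

Section Abelian.
Variables (k : fieldType) (C : linCat k).

Definition is_iso (X Y : C) (f : hom X Y) : Prop :=
  exists g : hom Y X, g \co f = idm X /\ f \co g = idm Y.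

Definition mono (X Y : C) (f : hom X Y) : Prop :=
  forall (T : C) (u v : hom T X), f \co u = f \co v -> u = v.

Definition epi (X Y : C) (f : hom X Y) : Prop :=
  forall (T : C) (u v : hom Y T), u \co f = v \co f -> u = v.

Definition is_kernel (X Y K : C) (f : hom X Y) (i : hom K X) : Prop :=
  f \co i = 0 /\
  forall (T : C) (t : hom T X), f \co t = 0 -> exists! u : hom T K, i \co u = t.

Definition is_cokernel (X Y Q : C) (f : hom X Y) (p : hom Y Q) : Prop :=
  p \co f = 0 /\
  forall (T : C) (t : hom Y T), t \co f = 0 -> exists! u : hom Q T, u \co p = t.

Definition is_zero (X : C) : Prop := idm X = 0.

Definition simple_object (X : C) : Prop :=
  ~ is_zero X /\
  forall (Y : C) (i : hom Y X), mono i -> is_zero Y \/ is_iso i.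

Definition contained (Z X : C) : Prop := exists i : hom Z X, mono i.

Record dirsum (I : finType) (X : I -> C) := Dirsum {
  ds :> C;
  inj : forall i : I, hom (X i) ds;
  proj : forall i : I, hom ds (X i);
  proj_inj : forall i : I, proj i \co inj i = idm (X i);
  proj_inj0 : forall i j : I, i != j -> proj j \co inj i = 0;
  sum_inj_proj : \sum_(i : I) inj i \co proj i = idm ds }.

(* Finite direct sums (the empty one being a zero object) are chosen, so that
   the regular objects below are actual objects of the category. *)
Record abelian := Abelian {
  dsum : forall (I : finType) (X : I -> C), dirsum X;
  has_kernels : forall (X Y : C) (f : hom X Y),
    exists (K : C) (i : hom K X), is_kernel f i;
  has_cokernels : forall (X Y : C) (f : hom X Y),
    exists (Q : C) (p : hom Y Q), is_cokernel f p;
  mono_is_kernel : forall (X Y : C) (i : hom X Y), mono i ->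
    exists (Z : C) (f : hom Y Z), is_kernel f i;
  epi_is_cokernel : forall (X Y : C) (p : hom X Y), epi p ->
    exists (Z : C) (f : hom Z X), is_cokernel f p }.

End Abelian.

Record monCat (k : fieldType) := MonCat {
  mcat :> linCat k;
  one : mcat;
  tens : mcat -> mcat -> mcat;
  tensm : forall X X' Y Y' : mcat,
    hom X X' -> hom Y Y' -> hom (tens X Y) (tens X' Y');
  tensm_id : forall X Y : mcat, tensm (idm X) (idm Y) = idm (tens X Y);
  tensm_comp : forall (X X' X'' Y Y' Y'' : mcat)
      (f' : hom X' X'') (f : hom X X') (g' : hom Y' Y'') (g : hom Y Y'),
    tensm (f' \co f) (g' \co g) = tensm f' g' \co tensm f g;
  tensm_linl : forall (X X' Y Y' : mcat) (g : hom Y Y'),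
    linear (fun f : hom X X' => tensm f g);
  tensm_linr : forall (X X' Y Y' : mcat) (f : hom X X'),
    linear (fun g : hom Y Y' => tensm f g);
  assoc : forall X Y Z : mcat, iso (tens (tens X Y) Z) (tens X (tens Y Z));
  lunit : forall X : mcat, iso (tens one X) X;
  runit : forall X : mcat, iso (tens X one) X;
  assoc_nat : forall (X X' Y Y' Z Z' : mcat)
      (f : hom X X') (g : hom Y Y') (h : hom Z Z'),
    assoc X' Y' Z' \co tensm (tensm f g) h
    = tensm f (tensm g h) \co assoc X Y Z;
  lunit_nat : forall (X Y : mcat) (f : hom X Y),
    lunit Y \co tensm (idm one) f = f \co lunit X;
  runit_nat : forall (X Y : mcat) (f : hom X Y),
    runit Y \co tensm f (idm one) = f \co runit X;
  pentagon : forall X Y Z W : mcat,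
    assoc X Y (tens Z W) \co assoc (tens X Y) Z W
    = tensm (idm X) (assoc Y Z W) \co assoc X (tens Y Z) W
        \co tensm (assoc X Y Z) (idm W);
  triangle : forall X Y : mcat,
    tensm (idm X) (lunit Y) \co assoc X one Y = tensm (runit X) (idm Y) }.

Arguments one {k m}.
Arguments tens {k m} X Y.
Arguments tensm {k m X X' Y Y'} f g.
Arguments assoc {k m} X Y Z.
Arguments lunit {k m} X.
Arguments runit {k m} X.

Notation "X \ox Y" := (tens X Y) (at level 40, left associativity).
Notation "f \om g" := (tensm f g) (at level 40, left associativity).

(* [Y] is a left dual of [X]; equivalently, [X] is a right dual of [Y]. *)
Definition left_dual (k : fieldType) (C : monCat k) (Y X : C) : Prop :=
  exists (ev : hom (Y \ox X) one) (coev : hom one (X \ox Y)),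
    runit X \co (idm X \om ev) \co assoc X Y X \co (coev \om idm X)
      \co bwd (lunit X) = idm X
    /\
    lunit Y \co (ev \om idm Y) \co bwd (assoc Y X Y) \co (idm Y \om coev)
      \co bwd (runit Y) = idm Y.

Record fusionCat (k : fieldType) := FusionCat {
  fcat :> monCat k;
  fabelian : abelian fcat;
  frigid : forall X : fcat,
    (exists Y : fcat, left_dual Y X) /\ (exists Y : fcat, left_dual X Y);
  fsemisimple : forall X : fcat, exists (I : finType) (Y : I -> fcat),
    (forall i : I, simple_object (Y i)) /\ inhabited (iso X (dsum fabelian Y));
  funit_simple : simple_object (@one k fcat);
  (* Representatives of the finitely many isomorphism classes of simple
     objects; 'I_nirr stands for O(C). *)
  nirr : nat;
  irr : 'I_nirr -> fcat;
  irr_simple : forall i : 'I_nirr, simple_object (irr i);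
  irr_inj : forall i j : 'I_nirr, inhabited (iso (irr i) (irr j)) -> i = j;
  irr_surj : forall X : fcat, simple_object X ->
    exists i : 'I_nirr, inhabited (iso X (irr i)) }.

Arguments irr {k f} i.

Definition bigsum (k : fieldType) (C : fusionCat k) (I : finType) (X : I -> C) :
  dirsum X := dsum (fabelian C) X.

Definition copies (k : fieldType) (C : fusionCat k) (I : finType) (X : C) :
  dirsum (fun _ : I => X) := bigsum (fun _ : I => X).

Section FrobeniusPerron.
Variables (k : fieldType) (C : fusionCat k).

(* Left multiplication by [X] on the Grothendieck ring, in the basis O(C); the
   multiplicity of a simple Z in an object is dim Hom(Z, -), k being
   algebraically closed in the applications. *)
Definition fusion_matrix (X : C) : 'M[algC]_(nirr C) :=
  \matrix_(i, j) (\dim {: hom (irr j) (X \ox irr i)})%:R.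

Definition eigenvalues (n : nat) (A : 'M[algC]_n) : seq algC :=
  sval (closed_field_poly_normal (char_poly A)).

(* The largest nonnegative real eigenvalue: in algC, [0 <= l] forces [l] to be
   real. *)
Definition FPdim (X : C) : algC :=
  \big[Num.max/0]_(l <- eigenvalues (fusion_matrix X) | 0 <= l) l.

Definition integral : Prop := forall X : C, FPdim X \is a Num.int.

(* Agrees with [FPdim] when [C] is integral. *)
Definition fpdim (X : C) : nat := Num.truncn (FPdim X).

Definition lfun_det (V : vectType k) (u : 'End(V)) : k :=
  \det (passmx.mxof (vbasis {:V}) (vbasis {:V}) u).

Definition det_aut (X : C) (phi : hom X X) : k :=
  \prod_(i < nirr C)
    lfun_det (linfun (fun u : hom (irr i) X => phi \co u)) ^+ fpdim (irr i).

End FrobeniusPerron.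

Record gradedFusion (k : fieldType) (G : finGroupType) := GradedFusion {
  gcat :> fusionCat k;
  deg : 'I_(nirr gcat) -> G;
  deg_mul : forall x y z : 'I_(nirr gcat),
    contained (irr z) (irr x \ox irr y) -> (deg x * deg y)%g = deg z }.

Section Alpha.
Variables (k : fieldType) (G : finGroupType) (C : gradedFusion k G).

(* FPdim(C_e) *)
Definition gdim : nat :=
  (\sum_(i < nirr C | deg i == 1%g) fpdim (irr i) ^ 2)%N.

Definition regular (g : G) : C :=
  bigsum (fun x : {i : 'I_(nirr C) | deg i == g} =>
            copies 'I_(fpdim (irr (val x))) (irr (val x)) : C).

(* The convention that R_f (x) R_g and D R_fg are equal, made explicit as a
   choice of identifications.  For integral C over an algebraically closed
   field of characteristic 0, they exist exactly when every C_g is nonzero. *)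
Definition regular_mul : Type :=
  forall f g : G,
    iso (regular f \ox regular g) (copies 'I_gdim (regular (f * g)%g)).

Variable J : regular_mul.

Definition mproj (f g : G) (a : 'I_gdim) :
    hom (regular f \ox regular g) (regular (f * g)%g) :=
  proj (copies 'I_gdim (regular (f * g)%g)) a \co J f g.

Definition minj (f g : G) (a : 'I_gdim) :
    hom (regular (f * g)%g) (regular f \ox regular g) :=
  bwd (J f g) \co inj (copies 'I_gdim (regular (f * g)%g)) a.

Definition regular2 (g : G) : dirsum (fun _ : 'I_gdim * 'I_gdim => regular g) :=
  copies ('I_gdim * 'I_gdim)%type (regular g).

(* D^2 R_fgh -> (R_f (x) R_g) (x) R_h: the first index comes from
   R_f (x) R_g = D R_fg and the second one from R_fg (x) R_h = D R_fgh. *)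
Definition triple_left (f g h : G) :
    hom (regular2 (f * g * h)%g) (regular f \ox regular g \ox regular h) :=
  \sum_(p : 'I_gdim * 'I_gdim)
    (minj f g p.1 \om idm (regular h)) \co minj (f * g)%g h p.2
      \co proj (regular2 (f * g * h)%g) p.

(* R_f (x) (R_g (x) R_h) -> D^2 R_fgh: the first index comes from
   R_f (x) R_gh = D R_fgh and the second one from R_g (x) R_h = D R_gh.
   The order matters: exchanging the two indices multiplies det(alpha)^D by the
   constant (-1)^(D^2 D(D-1)/2), which is -1 if D = 3 mod 4, and the constant
   function -1 is not a 3-cocycle. *)
Definition triple_right (f g h : G) :
    hom (regular f \ox (regular g \ox regular h)) (regular2 (f * g * h)%g) :=
  \sum_(p : 'I_gdim * 'I_gdim)
    inj (regular2 (f * g * h)%g) p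
      \co hom_of_eq (congr1 regular (mulgA f g h))
      \co mproj f (g * h)%g p.1 \co (idm (regular f) \om mproj g h p.2).

Definition regular_assoc (f g h : G) :
    hom (regular2 (f * g * h)%g) (regular2 (f * g * h)%g) :=
  triple_right f g h \co assoc (regular f) (regular g) (regular h)
    \co triple_left f g h.

Definition alphaC (f g h : G) : k := det_aut (regular_assoc f g h) ^+ gdim.

End Alpha.

Section Cocycles.
Variables (k : fieldType) (G : finGroupType).

Definition is_3cocycle (a : G -> G -> G -> k) : Prop :=
  (forall f g h : G, a f g h != 0) /\
  forall f g h l : G,
    a g h l * a f (g * h)%g l * a f g h = a (f * g)%g h l * a f g (h * l)%g.

Definition cohomologous (a a' : G -> G -> G -> k) : Prop :=
  exists b : G -> G -> k,
    (forall f g : G, b f g != 0) /\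
    forall f g h : G,
      a' f g h = a f g h *
        (b g h * (b (f * g)%g h)^-1 * b f (g * h)%g * (b f g)^-1).

End Cocycles.

Record tensorEquiv (k : fieldType) (C C' : monCat k) := TensorEquiv {
  fobj :> C -> C';
  fmap : forall X Y : C, hom X Y -> hom (fobj X) (fobj Y);
  fmap_lin : forall X Y : C, linear (@fmap X Y);
  fmap_id : forall X : C, fmap (idm X) = idm (fobj X);
  fmap_comp : forall (X Y Z : C) (g : hom Y Z) (f : hom X Y),
    fmap (g \co f) = fmap g \co fmap f;
  ftens : forall X Y : C, iso (fobj X \ox fobj Y) (fobj (X \ox Y));
  fone : iso one (fobj one);
  ftens_nat : forall (X X' Y Y' : C) (f : hom X X') (g : hom Y Y'),
    fmap (f \om g) \co ftens X Y = ftens X' Y' \co (fmap f \om fmap g);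
  ftens_assoc : forall X Y Z : C,
    fmap (assoc X Y Z) \co ftens (X \ox Y) Z \co (ftens X Y \om idm (fobj Z))
    = ftens X (Y \ox Z) \co (idm (fobj X) \om ftens Y Z)
        \co assoc (fobj X) (fobj Y) (fobj Z);
  ftens_lunit : forall X : C,
    fmap (lunit X) \co ftens one X \co (fone \om idm (fobj X))
    = lunit (fobj X);
  ftens_runit : forall X : C,
    fmap (runit X) \co ftens X one \co (idm (fobj X) \om fone)
    = runit (fobj X);
  fully_faithful : forall X Y : C, bijective (@fmap X Y);
  ess_surj : forall Y : C', exists X : C, inhabited (iso (fobj X) Y) }.

Definition grading_preserving (k : fieldType) (G : finGroupType)
    (C C' : gradedFusion k G) (F : tensorEquiv C C') : Prop :=
  forall (i : 'I_(nirr C)) (j : 'I_(nirr C')),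
    inhabited (iso (F (irr i)) (irr j)) -> deg j = deg i.

(* Main.v *)
(* The associator [assoc R_f R_g R_h] has, in the frames of [R_fgh]-components
   provided by J, a D^2 x D^2 matrix over End(R_fgh).  The pentagon is an identity
   between products of D^3 x D^3 matrices, each of which is either D diagonal
   copies of such a matrix, of determinant det^D, or its image under a functor
   [- (x) R_l] or [R_f (x) -].  The latter also raises the determinant to the
   power D, because [R_f (x) Z = d(Z) R_fg] for Z simple of degree g with d(Z) > 0:
   the multiplication table of the regular objects given by J exhibits R = sum R_g
   as an eigenvector of multiplication by R, unique up to scalar among those with
   the same support, so that Z R and R Z are multiples of R, and the
   Perron-Frobenius inequality identifies the factor with d(Z).  Two choices of J differ by
   matrices over End(R_fg) whose determinants form the coboundary, and a tensor
   equivalence transports everything without changing determinants. *)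

Require Import Defs.
From HB Require Import structures.
From mathcomp Require Import all_boot all_order all_algebra all_fingroup all_field.
From mathcomp Require Import ring.
Import Order.TTheory GRing.Theory Num.Theory.
Local Open Scope ring_scope.
Set Implicit Arguments.
Unset Strict Implicit.
Unset Printing Implicit Defensive.
(* MathComp shadows [hom], [idm], [abelian], ... of Defs. *)
Import Defs.

(** * Determinants of linear maps *)

(** The obstacle is [fpdim], a truncated eigenvalue: neither its multiplicativity nor its positivity
    on all simple objects is established. What replaces them is extracted from [J], and only for
    simple objects of positive [fpdim]; no others occur in the regular objects, so this suffices for
    every determinant in play. Tensoring with a regular object, taking copies and applying a tensor
    equivalence are treated as three instances of one statement about a linear functor H: if the
    dimension of H Z is c d(Z) for the simple Z occurring in X, then det(H f) = det(f)^c. The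
    factors are D, the number of copies, and 1. The power D in the cocycle comes from here: each of
    the five edges of the pentagon enters with exponent D, hence det^D, rather than det, satisfies
    the cocycle identity. These exponents have two origins, the size of the frames and the factor of
    tensoring, which are kept apart as [n] and [gdim C] because frames transported from C to C' have
    size [gdim C]. *)

Section LinearFunctions.
Variables (R : nzRingType) (U V : lmodType R) (f : U -> V).
Hypothesis f_lin : linear f.

Let f_linear : {linear U -> V} := HB.pack f (GRing.isLinear.Build R U V *:%R f f_lin).

Lemma lin0 : f 0 = 0. Proof. exact: (linear0 f_linear). Qed.
Lemma linD u v : f (u + v) = f u + f v. Proof. exact: (linearD f_linear). Qed.
Lemma linB u v : f (u - v) = f u - f v. Proof. exact: (linearB f_linear). Qed.
Lemma linZ a u : f (a *: u) = a *: f u. Proof. exact: (linearZ_LR f_linear). Qed.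
Lemma linsum I r (P : pred I) (E : I -> U) :
  f (\sum_(i <- r | P i) E i) = \sum_(i <- r | P i) f (E i).
Proof. exact: (linear_sum f_linear). Qed.

End LinearFunctions.

Lemma linfunE (F : fieldType) (U V : vectType F) (f : U -> V) :
  linear f -> linfun f =1 f.
Proof.
move=> fl u; pose g : {linear U -> V} := HB.pack f (GRing.isLinear.Build F U V *:%R f fl).
exact: (lfunE g).
Qed.

(** Both sides are the determinant of the block matrix with rows (1, -A) and (B, 1), factored by
    eliminating either diagonal block. *)
Lemma det_sylvester (R : comNzRingType) m n (A : 'M[R]_(m, n)) (B : 'M_(n, m)) :
  \det (1%:M + A *m B) = \det (1%:M + B *m A).
Proof.
have E1 : block_mx 1%:M 0 B 1%:M *m block_mx 1%:M (- A) 0 (1%:M + B *m A)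
          = block_mx 1%:M (- A) B 1%:M.
  rewrite mulmx_block !mul1mx !mulmx1 !mul0mx ?mulmx0 !addr0 mulmxN.
  by rewrite addrC addrK.
have E2 : block_mx (1%:M + A *m B) (- A) 0 1%:M *m block_mx 1%:M 0 B 1%:M
          = block_mx 1%:M (- A) B 1%:M.
  by rewrite mulmx_block !mul1mx !mulmx1 !mulmx0 !add0r mulNmx addrK.
have := congr1 determinant E1; rewrite -E2 !det_mulmx !det_ublock !det_lblock !det1.
by rewrite !mul1r !mulr1 => ->.
Qed.

Lemma natr_inj_pchar0 (R : idomainType) :
  [pchar R] =i pred0 -> injective (fun n => n%:R : R).
Proof.
move=> /pcharf0P R0 m n; wlog le_mn : m n / (m <= n)%N.
  by move=> W E; case: (leqP m n) => [/W-> //|/ltnW/W->].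
move=> E; apply/eqP; rewrite eqn_leq le_mn /= -subn_eq0 -R0 natrB //.
by rewrite subr_eq0 E.
Qed.

Section LfunDet.
Variable F : fieldType.
Implicit Types U V W : vectType F.

Let mx U V (f : 'Hom(U, V)) := passmx.mxof (vbasis {:U}) (vbasis {:V}) f.

Let mx_comp U V W (g : 'Hom(V, W)) (f : 'Hom(U, V)) : mx (g \o f)%VF = mx f *m mx g.
Proof. exact: (passmx.mxof_comp (vbasis {:U}) (vbasis {:W}) (vbasisP {:V})). Qed.

Let mx1 V : mx (\1%VF : 'End(V)) = 1%:M.
Proof. exact: passmx.mxof1 (basis_free (vbasisP _)). Qed.

Let mxD U V (f g : 'Hom(U, V)) : mx (f + g) = mx f + mx g.
Proof. exact: (linD (passmx.mxof_linear _ _)). Qed.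

Lemma lfun_det1 V : lfun_det (\1%VF : 'End(V)) = 1.
Proof. by rewrite /lfun_det [passmx.mxof _ _ _]mx1 det1. Qed.

Lemma lfun_detM V (u v : 'End(V)) : lfun_det (u \o v)%VF = lfun_det u * lfun_det v.
Proof. by rewrite /lfun_det [passmx.mxof _ _ _]mx_comp det_mulmx mulrC. Qed.

Lemma lfun_det_sylvester U V (f : 'Hom(U, V)) (g : 'Hom(V, U)) :
  lfun_det (\1 + (g \o f))%VF = lfun_det (\1 + (f \o g))%VF.
Proof.
rewrite /lfun_det -![passmx.mxof _ _ _]/(mx _) !mxD !mx_comp !mx1.
exact: det_sylvester.
Qed.

Lemma lfun_det_dim0 V (u : 'End(V)) : \dim {:V} = 0%N -> lfun_det u = 1.
Proof. by rewrite /lfun_det => V0; move: (passmx.mxof _ _ _); rewrite V0 => A; rewrite det_mx00. Qed.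

Section DirectSum.
Variables (I : finType) (W : I -> vectType F) (V : vectType F).
Variables (i : forall a, 'Hom(W a, V)) (p : forall a, 'Hom(V, W a)).
Hypothesis pi1 : forall a x, p a (i a x) = x.
Hypothesis pi0 : forall a b x, a != b -> p b (i a x) = 0.
Hypothesis ip1 : forall x, \sum_a i a (p a x) = x.

(** The dimension is the trace of the identity, and tr(i_a p_a) = tr(p_a i_a) = tr(1).
    Characteristic 0 turns this equality of scalars into one of natural numbers. *)
Lemma dim_direct_sum : [pchar F] =i pred0 -> \dim {:V} = (\sum_a \dim {:W a})%N.
Proof.
move=> F0; apply: (natr_inj_pchar0 F0); rewrite natr_sum.
have mx_sum (r : seq I) : mx (\sum_(a <- r) (i a \o p a)%VF) = \sum_(a <- r) mx (i a \o p a)%VF.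
  exact: (linsum (passmx.mxof_linear _ _)).
rewrite -mxtrace1 -mx1.
have -> : (\1%VF : 'End(V)) = \sum_a (i a \o p a)%VF.
  apply/lfunP => x; rewrite id_lfunE sum_lfunE -{1}(ip1 x).
  by apply: eq_bigr => a _; rewrite comp_lfunE.
rewrite mx_sum raddf_sum; apply: eq_bigr => a _ /=.
rewrite mx_comp mxtrace_mulC -mx_comp -mxtrace1 -mx1; congr (\tr (mx _)).
by apply/lfunP => x; rewrite comp_lfunE pi1 id_lfunE.
Qed.

(** Write u = 1 + sum t_a with t_a = i_a (v_a - 1) p_a. Since t_a t_b = 0 for distinct a and b, u is
    the product of the 1 + t_a, and Sylvester's identity gives each factor the determinant of v_a.
    This avoids block matrices with blocks of varying size. *)
Lemma lfun_det_direct_sum (u : 'End(V)) (v : forall a, 'End(W a)) :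
  (forall a x, u (i a x) = i a (v a x)) -> lfun_det u = \prod_a lfun_det (v a).
Proof.
move=> uiE.
pose t a := (i a \o (v a - \1) \o p a)%VF.
have det_t a : lfun_det (\1 + t a)%VF = lfun_det (v a).
  rewrite /t lfun_det_sylvester comp_lfunA; congr lfun_det; apply/lfunP => x.
  by rewrite !lfun_simp pi1 addrC subrK.
have uE : u = (\1 + \sum_a t a)%VF.
  apply/lfunP => x; rewrite add_lfunE sum_lfunE id_lfunE -{1 2}(ip1 x).
  rewrite linear_sum -big_split /=; apply: eq_bigr => a _.
  by rewrite uiE /t !comp_lfunE !lfun_simp linearB /= addrC subrK.
rewrite uE -(big_enum _ _ predT t) -(big_enum _ _ predT (fun a => lfun_det (v a))) /=.
have := enum_uniq I; elim: (enum I) => [_|a r IHr /= /andP[nar ur]].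
  by rewrite !big_nil addr0 lfun_det1.
rewrite !big_cons -{}IHr // -det_t -lfun_detM; congr lfun_det.
rewrite comp_lfunDl !comp_lfunDr !comp_lfun1l comp_lfun1r.
rewrite [(t a \o _)%VF](_ : _ = 0) ?addr0; first by rewrite addrA addrAC.
apply/lfunP => x; rewrite comp_lfunE sum_lfunE zero_lfunE raddf_sum big_seq big1 // => b br.
have ba : b != a by apply: contraNneq nar => <-.
by rewrite /= /t !comp_lfunE pi0 // !linear0.
Qed.

End DirectSum.
End LfunDet.

Lemma lfun_eigenvector (k : closedFieldType) (V : vectType k) (L : 'End(V)) :
  (0 < \dim {:V})%N -> exists c u, u != 0 /\ L u = c *: u.
Proof.
move=> V0; pose A := passmx.mxof (vbasis {:V}) (vbasis {:V}) L.
have /closed_rootP[c] : size (char_poly A) != 1%N by rewrite size_char_poly; case: (\dim _) V0.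
rewrite -eigenvalue_root_char => /eigenvalueP[v vA v0].
exists c, (passmx.vecof (vbasis {:V}) v).
have b := vbasisP {:V}; split; first by rewrite passmx.vecof_eq0.
by rewrite (passmx.hom_vecof _ b) vA (linZ (passmx.vecof_linear _)).
Qed.

(** * Semisimple categories *)

Section CompLinear.
Variables (k : fieldType) (C : linCat k) (X Y Z : C).
Implicit Types (f : hom X Y) (g : hom Y Z).

Lemma comp0l f : (0 : hom Y Z) \co f = 0. Proof. exact: (lin0 (comp_linl f)). Qed.
Lemma comp0r g : g \co (0 : hom X Y) = 0. Proof. exact: (lin0 (comp_linr g)). Qed.
Lemma compDr g f f' : g \co (f + f') = g \co f + g \co f'.
Proof. exact: (linD (comp_linr g)). Qed.
Lemma compDl g g' f : (g + g') \co f = g \co f + g' \co f.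
Proof. exact: (linD (comp_linl f)). Qed.
Lemma compBl g g' f : (g - g') \co f = g \co f - g' \co f.
Proof. exact: (linB (comp_linl f)). Qed.
Lemma compBr g f f' : g \co (f - f') = g \co f - g \co f'.
Proof. exact: (linB (comp_linr g)). Qed.
Lemma compZl c g f : (c *: g) \co f = c *: (g \co f).
Proof. exact: (linZ (comp_linl f)). Qed.
Lemma compZr c g f : g \co (c *: f) = c *: (g \co f).
Proof. exact: (linZ (comp_linr g)). Qed.
Lemma comp_suml I r (P : pred I) (G : I -> hom Y Z) f :
  (\sum_(i <- r | P i) G i) \co f = \sum_(i <- r | P i) G i \co f.
Proof. exact: (linsum (comp_linl f)). Qed.
Lemma comp_sumr I r (P : pred I) g (F : I -> hom X Y) :
  g \co (\sum_(i <- r | P i) F i) = \sum_(i <- r | P i) g \co F i.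
Proof. exact: (linsum (comp_linr g)). Qed.

End CompLinear.

Section Simple.
Variables (k : closedFieldType) (C : linCat k).
Hypothesis abC : abelian C.

Lemma simple_mono (X Y : C) (f : hom X Y) : simple_object X -> f != 0 -> mono f.
Proof.
move=> [_ sX] f0; have [K [i [fi0 iker]]] := has_kernels abC f.
have i_mono : mono i.
  move=> T u v iuv; have [|w [_ w_uniq]] := iker _ (i \co u).
    by rewrite comp_assoc fi0 comp0l.
  by rewrite -(w_uniq u) // -(w_uniq v).
case: (sX _ _ i_mono) => [K0 | [j [_ ij]]]; last first.
  case/eqP: f0; rewrite -[f]comp_idr -ij comp_assoc fi0 comp0l //.
move=> T u v fuv; apply/eqP; rewrite -subr_eq0; apply/eqP.
have [|w [<- _]] := iker _ (u - v); first by rewrite compBr fuv subrr.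
by rewrite -[w]comp_idl K0 comp0l comp0r.
Qed.

Lemma simple_hom_iso (X Y : C) (f : hom X Y) :
  simple_object X -> simple_object Y -> f != 0 -> is_iso f.
Proof.
move=> sX [_ sY] f0; case: (sY _ _ (simple_mono sX f0)) => // X0.
by case: sX.
Qed.

(** Schur's lemma: composition with f on End(X) has an eigenvector u, so f - c kills a nonzero u, is
    not mono, and must vanish. *)
Lemma simple_end (X : C) (f : hom X X) : simple_object X -> exists c, f = c *: idm X.
Proof.
move=> sX; have V0 : (0 < \dim {: hom X X})%N.
  rewrite lt0n dimv_eq0; apply: contra_not_neq sX.1 => V0; apply/eqP.
  by rewrite -memv0 -V0 memvf.
have [c [u [u0]]] := lfun_eigenvector (linfun (fun u : hom X X => f \co u)) V0.
rewrite (linfunE (comp_linr f)) => fu; exists c; apply/eqP; rewrite -subr_eq0.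
apply: contraNT u0 => /(simple_mono sX)/(_ _ u 0); rewrite comp0r compBl fu compZl comp_idl subrr.
by move=> /(_ erefl)->.
Qed.

Lemma dim_simple_hom (X Y : C) : simple_object X -> simple_object Y ->
  (inhabited (iso X Y) /\ \dim {: hom X Y} = 1%N) \/
  (~ inhabited (iso X Y) /\ \dim {: hom X Y} = 0%N).
Proof.
move=> sX sY; case: (eqVneq (\dim {: hom X Y}) 0%N) => [d0|].
  right; split => // -[f]; case: sX => nX _; apply: nX; rewrite /is_zero -(bwdK f).
  move/eqP: d0; rewrite dimv_eq0 => /eqP V0.
  have /eqP-> : fwd f == 0 by rewrite -memv0 -V0 memvf.
  by rewrite comp0r.
rewrite dimv_eq0 -vpick0; set f := vpick _ => f0; left.
have [g [gf fg]] := simple_hom_iso sX sY f0; split; first by exists; exists (f : hom X Y) g.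
suff -> : {: hom X Y}%VS = <[f]>%VS by rewrite dim_vline f0.
apply/eqP; rewrite eqEsubv subvf andbT; apply/subvP => h _.
have [c gh] := simple_end (g \co h) sX.
apply/vlineP; exists c.
by rewrite -[h]comp_idl -fg -comp_assoc gh compZr comp_idr.
Qed.

End Simple.

Record linFunctor (k : fieldType) (C C' : linCat k) := LinFunctor {
  fob :> C -> C';
  fhom : forall X Y : C, hom X Y -> hom (fob X) (fob Y);
  fhom_lin : forall X Y : C, linear (@fhom X Y);
  fhom_id : forall X : C, fhom (idm X) = idm (fob X);
  fhom_comp : forall (X Y Z : C) (g : hom Y Z) (f : hom X Y),
    fhom (g \co f) = fhom g \co fhom f }.

(** * Multiplicity spaces of simple objects and the determinants computed on them *)

Section Multiplicity.
Variables (k : closedFieldType) (C : fusionCat k).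

Lemma irr_dim (i j : 'I_(nirr C)) : \dim {: hom (irr i) (irr j)} = (i == j).
Proof.
have [[/irr_inj-> ->]|[nij ->]] :=
  dim_simple_hom (fabelian C) (irr_simple i) (irr_simple j); first by rewrite eqxx.
case: eqP => // eij; case: nij; rewrite eij; exists.
by exists (idm (irr j)) (idm (irr j)); rewrite comp_idl.
Qed.

Lemma irr_hom0 (i j : 'I_(nirr C)) (f : hom (irr i) (irr j)) : i != j -> f = 0.
Proof.
move=> /negPf nij; apply/eqP; rewrite -memv0; suff <- : {: hom (irr i) (irr j)}%VS = 0%VS by rewrite memvf.
by apply/eqP; rewrite -dimv_eq0 irr_dim nij.
Qed.

Lemma irr_end (i : 'I_(nirr C)) (f : hom (irr i) (irr i)) : exists c, f = c *: idm (irr i).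
Proof. exact: (simple_end (fabelian C) f (irr_simple i)). Qed.


Local Notation mult z X := (\dim {: hom (irr z) X}).
Local Notation basis z X := (vbasis {: hom (irr z) X}).

(** Any map factoring through a simple object is expanded in the chosen bases of the multiplicity
    spaces. Summed over a semisimple decomposition of X, this resolves the identity of X without
    matching the summands with basis vectors. *)
Let span_vbasis (X Y : C) (z0 : 'I_(nirr C)) (s : hom (irr z0) X) (q : hom Y (irr z0)) :
  exists p : forall z, 'I_(mult z X) -> hom Y (irr z),
  \sum_z \sum_(m < mult z X) (basis z X)`_m \co p z m = s \co q.
Proof.
have /fin_all_exists[p pE] z : exists p : 'I_(mult z X) -> hom Y (irr z),
    \sum_(m < mult z X) (basis z X)`_m \co p m = if z == z0 then s \co q else 0.
  case: eqP => [->|_].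
    exists (fun m => coord (basis z0 X) m s *: q).
    rewrite {2}(coord_vbasis (memvf s)) comp_suml; apply: eq_bigr => m _.
    by rewrite compZl compZr.
  by exists (fun _ => 0); apply: big1 => m _; rewrite comp0r.
by exists p; rewrite (eq_bigr _ (fun z _ => pE z)) -big_mkcond big_pred1_eq.
Qed.

Let id_vbasis (X : C) : exists p : forall z, 'I_(mult z X) -> hom X (irr z),
  \sum_z \sum_(m < mult z X) (basis z X)`_m \co p z m = idm X.
Proof.
have [I [Y [sY [e]]]] := fsemisimple X.
have /fin_all_exists[t tP] i := irr_surj (sY i).
have /fin_all_exists[p pE] i : exists p : forall z, 'I_(mult z X) -> hom X (irr z),
    \sum_z \sum_(m < mult z X) (basis z X)`_m \co p z m
    = bwd e \co inj (dsum (fabelian C) Y) i \co proj (dsum (fabelian C) Y) i \co fwd e.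
  have [r] := tP i.
  have [p pE] := span_vbasis (bwd e \co inj (dsum (fabelian C) Y) i \co bwd r)
                  (fwd r \co proj (dsum (fabelian C) Y) i \co fwd e).
  exists p; rewrite pE !comp_assoc; congr (_ \co _ \co _).
  by rewrite -(comp_assoc _ (bwd r)) bwdK comp_idr.
exists (fun z m => \sum_i p i z m).
have -> : idm X = \sum_i \sum_z \sum_(m < mult z X) (basis z X)`_m \co p i z m.
  rewrite -(bwdK e) -{1}[fwd e]comp_idl -(sum_inj_proj (dsum (fabelian C) Y)).
  by rewrite comp_suml comp_sumr; apply: eq_bigr => i _; rewrite pE !comp_assoc.
rewrite exchange_big; apply: eq_bigr => z _; rewrite exchange_big.
by apply: eq_bigr => m _; rewrite comp_sumr.
Qed.

(** The sections s are the basis vectors. By Schur each p_l s_m' is a scalar c_l, and composing the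
    resolved identity with s_m' gives s_m' = sum c_l s_l; freeness of the basis forces c_l to be the
    Kronecker delta. The parameter [n] allows objects with equal multiplicities to be decomposed
    over the same index sets. *)
Lemma irr_decomposition (X : C) (n : 'I_(nirr C) -> nat) :
  (forall z, mult z X = n z) ->
  exists (s : forall z, 'I_(n z) -> hom (irr z) X) (p : forall z, 'I_(n z) -> hom X (irr z)),
    (forall z m m', p z m \co s z m' = (m == m')%:R *: idm (irr z)) /\
    \sum_z \sum_m s z m \co p z m = idm X.
Proof.
move=> dimX; have [p pE] := id_vbasis X.
have pz z : exists (s : 'I_(n z) -> hom (irr z) X) (q : 'I_(n z) -> hom X (irr z)),
    (forall m m', q m \co s m' = (m == m')%:R *: idm (irr z)) /\
    \sum_m s m \co q m = \sum_(m < mult z X) (basis z X)`_m \co p z m.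
  rewrite -(dimX z).
  exists (fun m : 'I_(mult z X) => (basis z X)`_m : hom (irr z) X), (p z).
  split => // m m'.
  have /fin_all_exists[c cE] l := irr_end (p z l \co (basis z X)`_m').
  rewrite cE; congr (_ *: _); have fb := basis_free (vbasisP {: hom (irr z) X}).
  rewrite -(coord_sum_free c m fb) eq_sym -(coord_free m' m fb); congr (coord _ _ _).
  rewrite -[RHS]comp_idl -pE comp_suml (bigD1 z) //= [X in _ = _ + X]big1 ?addr0.
    by rewrite comp_suml; apply: eq_bigr => l _; rewrite -comp_assoc cE compZr comp_idr.
  move=> z' zz'; rewrite comp_suml big1 // => l _; rewrite -comp_assoc.
  by rewrite (irr_hom0 (p z' l \co _)) ?comp0r // eq_sym.
have [s sP] := fin_all_exists pz; have [q qP] := fin_all_exists sP.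
exists s, q; split => [z|]; first by case: (qP z).
by rewrite -pE; apply: eq_bigr => z _; case: (qP z).
Qed.

Section Functor.
Variables (C' : linCat k) (H : linFunctor C C') (w : C') (X : C).
Let A := {z : 'I_(nirr C) & 'I_(\dim {: hom w (H (irr z))})}.

(** Hom(w, H X) is the sum over z of Hom(z, X) (x) Hom(w, H z). It is presented as copies of Hom(z,
    X) indexed by a basis of the second factor, so that composition with H f acts on each copy as
    composition with f. *)
Let functor_sum : exists
    (i : forall a : A, 'Hom(hom (irr (tag a)) X, hom w (H X)))
    (p : forall a : A, 'Hom(hom w (H X), hom (irr (tag a)) X)),
  [/\ forall a x, p a (i a x) = x,
      forall a b x, a != b -> p b (i a x) = 0,
      forall x, \sum_a i a (p a x) = x
    & forall (f : hom X X) a x, i a (f \co x) = fhom H f \co i a x].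
Proof.
have [s [p [ps sp]]] := @irr_decomposition X (fun z => mult z X) (fun=> erefl).
pose t (a : A) := (vbasis {: hom w (H (irr (tag a)))})`_(tagged a).
pose c (a : A) := coord (vbasis {: hom w (H (irr (tag a)))}) (tagged a).
pose i (a : A) (x : hom (irr (tag a)) X) : hom w (H X) := fhom H x \co t a.
pose q (a : A) (y : hom w (H X)) : hom (irr (tag a)) X :=
  \sum_m c a (fhom H (p _ m) \co y) *: s _ m.
have i_lin a : linear (i a).
  by move=> e x y; rewrite /i (fhom_lin H) (comp_linl (t a)).
have q_lin a : linear (q a).
  move=> e x y; rewrite /q scaler_sumr -big_split; apply: eq_bigr => m _ /=.
  by rewrite compDr compZr /c linearP scalerDl scalerA.
exists (fun a => linfun (i a)), (fun a => linfun (q a)).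
have qi z j j' (x : hom (irr z) X) :
    q (Tagged _ j') (i (Tagged _ j) x) = (j == j')%:R *: x.
  rewrite -[x in RHS]comp_idl -sp comp_suml (bigD1 z) //= [X in _ = _ *: (_ + X)]big1 ?addr0.
    rewrite comp_suml scaler_sumr; apply: eq_bigr => m _.
    rewrite /i comp_assoc -fhom_comp -comp_assoc.
    have [e ->] := irr_end (p z m \co x).
    rewrite (linZ (@fhom_lin _ _ _ H _ _)) fhom_id compZl comp_idl /c linearZ /= compZr comp_idr.
    by rewrite /t coord_free ?(basis_free (vbasisP _)) //= mulrC scalerA.
  move=> z' zz'; rewrite comp_suml big1 // => l _; rewrite -comp_assoc.
  by rewrite (irr_hom0 (p z' l \co _)) ?comp0r // eq_sym.
have qi0 a b x : tag a != tag b -> q b (i a x) = 0.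
  move=> ab; rewrite /q big1 // => m _; rewrite /i comp_assoc -fhom_comp.
  by rewrite (irr_hom0 (p _ _ \co _) ab) (lin0 (@fhom_lin _ _ _ H _ _)) comp0l /c linear0 scale0r.
split=> [a x|a b x ab|x|f a x]; rewrite ?(linfunE (i_lin _)) ?(linfunE (q_lin _)).
- by case: a x => z j x; rewrite qi eqxx scale1r.
- have [tab|] := eqVneq (tag a) (tag b); last exact: qi0.
  case: a b tab x ab => [z j] [z' j'] /= zz'; subst z' => x ab.
  rewrite qi (_ : (j == j') = false) ?scale0r //; apply: contraNF ab => /eqP->; exact: eqxx.
- rewrite -[RHS]comp_idl -fhom_id -sp.
  rewrite (linsum (@fhom_lin _ _ _ H _ _)) comp_suml.
  pose G (z : 'I_(nirr C)) (j : 'I_(\dim {: hom w (H (irr z))})) : hom w (H X) :=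
    i (Tagged _ j) (q (Tagged (fun z => 'I_(\dim {: hom w (H (irr z))})) j) x).
  transitivity (\sum_(a : A) G (tag a) (tagged a)).
    by apply: eq_bigr => -[z j] _; rewrite !(linfunE (i_lin _)) (linfunE (q_lin _)).
  rewrite -(sig_big_dep predT (fun _ => predT) G) /=; apply: eq_bigr => z _.
  rewrite (linsum (@fhom_lin _ _ _ H _ _)) comp_suml.
  under [LHS]eq_bigr do rewrite /G (linsum (i_lin _)).
  rewrite /= exchange_big /=.
  apply: eq_bigr => m _; rewrite fhom_comp -comp_assoc.
  rewrite {2}(coord_vbasis (memvf (fhom H (p z m) \co x))) comp_sumr.
  by apply: eq_bigr => j _; rewrite (linZ (i_lin _)) compZr.
by rewrite /i fhom_comp comp_assoc.
Qed.

Lemma dim_functor : [pchar k] =i pred0 ->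
  \dim {: hom w (H X)} = (\sum_z mult z X * \dim {: hom w (H (irr z))})%N.
Proof.
move=> k0; have [i [p [pi pi0 ip _]]] := functor_sum.
rewrite (dim_direct_sum pi ip k0).
have := sig_big_dep (idx := 0%N) (op := addn) predT
  (fun _ => predT) (fun z (_ : 'I_(\dim {: hom w (H (irr z))})) => mult z X).
move=> /= <-; apply: eq_bigr => z _; by rewrite sum_nat_const card_ord mulnC.
Qed.

Lemma lfun_det_functor (f : hom X X) :
  lfun_det (linfun (fun u : hom w (H X) => fhom H f \co u)) =
  \prod_z lfun_det (linfun (fun u : hom (irr z) X => f \co u))
             ^+ \dim {: hom w (H (irr z))}.
Proof.
have [i [p [pi pi0 ip fi]]] := functor_sum.
pose v (a : A) : 'End(hom (irr (tag a)) X) := linfun (fun u => f \co u).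
rewrite (lfun_det_direct_sum (v := v) pi pi0 ip); last first.
  by move=> a x; rewrite (linfunE (comp_linr _)) -fi (linfunE (comp_linr _)).
have := sig_big_dep (idx := 1) (op := *%R) predT
  (fun _ => predT) (fun z (_ : 'I_(\dim {: hom w (H (irr z))})) =>
    lfun_det (linfun (fun u : hom (irr z) X => f \co u))).
by move=> /= <-; apply: eq_bigr => z _; rewrite prodr_const card_ord.
Qed.

End Functor.

Lemma dim_dirsum (w : C) (I : finType) (X : I -> C) (S : dirsum X) :
  [pchar k] =i pred0 -> \dim {: hom w S} = (\sum_i \dim {: hom w (X i)})%N.
Proof.
move=> k0; pose i a : 'Hom(hom w (X a), hom w S) := linfun (fun u => inj S a \co u).
pose p a : 'Hom(hom w S, hom w (X a)) := linfun (fun u => proj S a \co u).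
apply: (dim_direct_sum (i := i) (p := p) _ _ k0).
- by move=> a x; rewrite !(linfunE (comp_linr _)) comp_assoc proj_inj comp_idl.
move=> x; rewrite -[RHS]comp_idl -(sum_inj_proj S) comp_suml.
by apply: eq_bigr => a _; rewrite !(linfunE (comp_linr _)) comp_assoc.
Qed.

Lemma iso_of_mult (X Y : C) : (forall z, mult z X = mult z Y) -> inhabited (iso X Y).
Proof.
move=> XY; have [s [p [ps sp]]] := irr_decomposition XY.
have [t [q [qt tq]]] := @irr_decomposition Y _ (fun=> erefl).
have key (U V W : C) s1 (p1 : forall z, 'I_(mult z Y) -> hom U (irr z)) s2
    (p2 : forall z, 'I_(mult z Y) -> hom V (irr z)) :
    (forall z m m', p2 z m \co s1 z m' = (m == m')%:R *: idm (irr z)) ->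
    (\sum_z \sum_m (s2 z m : hom (irr z) W) \co p2 z m) \co (\sum_z \sum_m s1 z m \co p1 z m)
    = \sum_z \sum_m s2 z m \co p1 z m.
  move=> ps1; rewrite comp_suml; apply: eq_bigr => z _.
  rewrite comp_suml; apply: eq_bigr => m _.
  rewrite comp_sumr (bigD1 z) //= [X in _ + X]big1 ?addr0 => [|z' zz'].
    rewrite comp_sumr (bigD1 m) //= [X in _ + X]big1 ?addr0 => [|m' mm'].
      by rewrite comp_assoc -(comp_assoc (s2 z m)) ps1 eqxx scale1r comp_idr.
    by rewrite comp_assoc -(comp_assoc (s2 z m)) ps1 eq_sym (negPf mm') scale0r comp0r comp0l.
  rewrite comp_sumr big1 // => m' _; rewrite comp_assoc -(comp_assoc (s2 z m)).
  by rewrite (irr_hom0 (p2 _ _ \co _) zz') comp0r comp0l.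
exists; exists (\sum_z \sum_m t z m \co p z m) (\sum_z \sum_m s z m \co q z m).
  by rewrite (key _ _ _ _ _ _ _ qt).
by rewrite (key _ _ _ _ _ _ _ ps).
Qed.

Lemma det_autM (X : C) (f g : hom X X) : det_aut (f \co g) = det_aut f * det_aut g.
Proof.
rewrite /det_aut -big_split; apply: eq_bigr => i _; rewrite /= -exprMn -lfun_detM.
congr (lfun_det _ ^+ _); apply/lfunP => u.
by rewrite comp_lfunE !(linfunE (comp_linr _)) comp_assoc.
Qed.

Lemma det_aut1 (X : C) : det_aut (idm X) = 1.
Proof.
rewrite /det_aut big1 // => i _; rewrite -[RHS](expr1n _ (fpdim (irr i))) -(lfun_det1 (hom (irr i) X)).
congr (lfun_det _ ^+ _); apply/lfunP => u.
by rewrite id_lfunE (linfunE (comp_linr _)) comp_idl.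
Qed.

Lemma det_aut_conj (X Y : C) (u : hom X Y) (v : hom Y X) (f : hom X X) :
  v \co u = idm X -> u \co v = idm Y -> det_aut (u \co f \co v) = det_aut f.
Proof.
move=> vu uv; apply: eq_bigr => i _; congr (_ ^+ _).
pose l (_ : unit) : 'Hom(hom (irr i) X, hom (irr i) Y) := linfun (fun x => u \co x).
pose r (_ : unit) : 'Hom(hom (irr i) Y, hom (irr i) X) := linfun (fun x => v \co x).
rewrite (@lfun_det_direct_sum _ _ _ _ l r _ _ _ _ (fun _ => linfun (fun x => f \co x))).
- by rewrite (big_pred1 tt) //; case.
- by move=> a x; rewrite !(linfunE (comp_linr _)) comp_assoc vu comp_idl.
- by case; case.
- by move=> x; rewrite (big_pred1 tt) ?(linfunE (comp_linr _)) ?comp_assoc ?uv ?comp_idl //; case.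
by move=> a x; rewrite !(linfunE (comp_linr _)) !comp_assoc -(comp_assoc _ v u) vu comp_idr.
Qed.

End Multiplicity.

(** The determinant of f on Hom(z, X) gets as exponent the sum over w of dim Hom(w, H z) d(w), that
    is, the dimension of H z. Where z does not occur in X the multiplicity space is zero and its
    determinant is 1. *)
Lemma det_aut_functor (k : closedFieldType) (C C' : fusionCat k) (H : linFunctor C C')
    (X : C) (D : nat) (f : hom X X) :
  (forall z : 'I_(nirr C), (0 < \dim {: hom (irr z) X})%N ->
     (\sum_(w < nirr C') \dim {: hom (irr w) (H (irr z))} * fpdim (irr w) = D * fpdim (irr z))%N) ->
  det_aut (fhom H f) = det_aut f ^+ D.
Proof.
move=> HD; rewrite /det_aut; under eq_bigr do rewrite lfun_det_functor -prodrXl.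
rewrite -prodrXl.
rewrite exchange_big; apply: eq_bigr => z _ /=.
under eq_bigr do rewrite -exprM; rewrite prodrXr.
case: (posnP (\dim {: hom (irr z) X})) => [z0|/HD ->]; last by rewrite mulnC exprM.
by rewrite (lfun_det_dim0 _ z0) !expr1n.
Qed.

(** * Perron-Frobenius theory of fusion rules *)

Section PerronFrobenius.

(** The order is only partial, as on [algC]. The induction therefore compares each partial maximum
    with the upper bound c alone. *)
Lemma bigmax_ge0_eq (R : numDomainType) (s : seq R) (c : R) :
  c \in s -> 0 <= c -> (forall l, l \in s -> 0 <= l -> l <= c) ->
  \big[Num.max/0]_(l <- s | 0 <= l) l = c.
Proof.
move=> cs c0 sc.
have [_ _ /(_ cs)->//] : let m := \big[Num.max/0]_(l <- s | 0 <= l) l in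
  [/\ 0 <= m, m <= c & c \in s -> m = c].
elim: s sc {cs} => [|a s IHs] sc; first by rewrite big_nil.
have [|m0 mc mE] := IHs; first by move=> l ls; apply: sc; rewrite in_cons ls orbT.
rewrite /= big_cons; set m := \big[_/_]_(_ <- _ | _) _ in m0 mc mE *.
case: ifPn => [a0|na0]; last first.
  split=> //; rewrite in_cons => /orP[/eqP ca|/mE//]; by rewrite -ca c0 in na0.
have ac : a <= c by apply: sc; rewrite ?mem_head.
rewrite /Num.max; case: ifPn => am; split=> //.
  rewrite in_cons => /orP[/eqP ca|/mE//]; move: am; rewrite -ca lt_leAnge mc andbF //.
rewrite in_cons => /orP[/eqP//|/mE me]; apply/eqP; move: am; rewrite me lt_neqAle ac andbT.
by rewrite negbK.
Qed.

Variables (n : nat) (M : 'M[algC]_n) (w : 'rV[algC]_n) (c : algC).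
Hypothesis M0 : forall i j, 0 <= M i j.
Hypothesis w0 : forall j, 0 < w 0 j.
Hypothesis wM : w *m M = c *: w.

(** At an index j maximizing |v_j| / w_j, the triangle inequality in v M = l v bounds l |v_j| by
    (|v_j| / w_j) (w M)_j = c |v_j|. *)
Lemma eigenvalue_le (l : algC) : 0 <= l -> eigenvalue M l -> l <= c.
Proof.
move=> l0 /eigenvalueP[v vM vn0].
have [j0 vj0] : exists j, v 0 j != 0 by apply/rV0Pn.
pose r j := `|v 0 j| / w 0 j.
have r0 j : r j \is Num.real by rewrite ger0_real // divr_ge0 // ltW.
have [j _ rj] := @real_arg_maxP _ _ j0 predT r isT (fun i _ => r0 i).
have rj' i : `|v 0 i| <= r j * w 0 i by rewrite -ler_pdivrMr //; apply: rj.
have rj0 : 0 < r j by apply: lt_le_trans (rj j0 isT); rewrite divr_gt0 ?normr_gt0.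
have vE : `|v 0 j| = r j * w 0 j by rewrite mulfVK // gt_eqF.
rewrite -(ler_pM2r (mulr_gt0 rj0 (w0 j))) -vE.
have /rowP/(_ j) := vM; rewrite !mxE => /(congr1 Num.norm); rewrite normrM (ger0_norm l0) => <-.
apply: le_trans (ler_norm_sum _ _ _) _.
have /rowP/(_ j) := wM; rewrite !mxE vE mulrCA => <-; rewrite mulr_sumr.
apply: ler_sum => i _; rewrite normrM (ger0_norm (M0 _ _)) mulrA.
by rewrite ler_wpM2r.
Qed.

Lemma FP_eigenvalue_eq (s : seq algC) :
  char_poly M = \prod_(z <- s) ('X - z%:P) -> (0 < n)%N -> 0 <= c ->
  \big[Num.max/0]_(l <- s | 0 <= l) l = c.
Proof.
move=> sE n0 c0; have in_s l : (l \in s) = eigenvalue M l.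
  by rewrite eigenvalue_root_char sE root_prod_XsubC.
apply: bigmax_ge0_eq => // [|l]; last by rewrite in_s => ls l0; apply: eigenvalue_le.
rewrite in_s; apply/eigenvalueP; exists w => //; apply/rV0Pn; exists (Ordinal n0).
by rewrite gt_eqF.
Qed.

End PerronFrobenius.

(** * Uniqueness of a Perron-Frobenius eigenvector with prescribed support *)

Section MinMax.
Variables (O : finType) (u : O) (A : O -> O -> rat) (d : O -> rat) (lam : rat).
Hypothesis A0 : forall x y, 0 <= A x y.
Hypothesis d0 : forall x, 0 <= d x.
Hypothesis Au : forall x, A u x = d x.
Hypothesis du : d u = 1.
Hypothesis dA : forall y, \sum_x d x * A x y = lam * d y.

(* Let j maximize v/d.  The nonnegative eigenvector [(v j / d j) d - v] vanishes at
   j, hence at u since [A u j = d j > 0]: the maximum is attained at u. *)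
Let eigenvector_le (v : O -> rat) : (forall y, \sum_x v x * A x y = lam * v y) ->
  (forall x, d x = 0 -> v x = 0) -> forall x, v x <= v u * d x.
Proof.
move=> vA v0; have du0 : 0 < d u by rewrite du.
have [j dj rj] := @arg_maxP _ _ _ u (fun x => 0 < d x) (fun x => v x / d x) du0.
set r := v j / d j in rj.
have e0 x : 0 <= r * d x - v x.
  rewrite subr_ge0; have := d0 x; rewrite le0r => /orP[/eqP dx|dx]; last first.
    by rewrite -ler_pdivrMr //; apply: rj.
  by rewrite dx v0 // mulr0.
have vj : r * d j = v j by rewrite mulfVK // gt_eqF.
have : \sum_x (r * d x - v x) * A x j = 0.
  under eq_bigr do rewrite mulrBl -mulrA.
  by rewrite sumrB -mulr_sumr dA vA mulrCA vj subrr.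
move/eqP; rewrite psumr_eq0; last by move=> x _; apply: mulr_ge0.
move=> /allP/(_ u (mem_index_enum _)) /=; rewrite Au mulf_eq0 (gt_eqF dj) orbF.
by rewrite du mulr1 subr_eq0 => /eqP <- x; rewrite -subr_ge0.
Qed.

(** The bound for v and the bound for -v together give equality; eigenvectors are rational, not
    natural, to allow this sign. *)
Lemma eigenvector_unique (v : O -> rat) : (forall y, \sum_x v x * A x y = lam * v y) ->
  (forall x, d x = 0 -> v x = 0) -> forall x, v x = v u * d x.
Proof.
move=> vA v0 x; apply/eqP; rewrite eq_le eigenvector_le //=.
rewrite -lerN2 -mulNr; apply: (@eigenvector_le (fun x => - v x)) => [y|y /v0->]; last exact: oppr0.
by under eq_bigr do rewrite mulNr; rewrite sumrN vA mulrN.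
Qed.

End MinMax.

(** * Absorption of simple elements by the regular element R = sum d(x) x *)

Section FusionRule.
Variables (O : finType) (u : O) (N : O -> O -> O -> nat) (d : O -> nat) (lam : nat).
Hypothesis N_assoc : forall x y z t,
  (\sum_w N x y w * N w z t = \sum_w N y z w * N x w t)%N.
Hypothesis N_unitl : forall x y, N u x y = (x == y).
Hypothesis N_regular : forall z, (\sum_x \sum_y d x * d y * N x y z = lam * d z)%N.
Hypothesis d_unit : d u = 1%N.

(** Here v is the class of z R and A is right multiplication by R. Associativity gives (z R) R = z
    (R R) = lam z R, and as z occurs in R, z R is supported in R R = lam R. Uniqueness of the
    eigenvector R of A then makes z R a multiple of R. *)
Lemma regular_mulr z : (0 < d z)%N ->
  exists c, forall t, (\sum_x d x * N z x t = c * d t)%N.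
Proof.
move=> dz; pose v t := (\sum_x d x * N z x t)%N; exists (v u).
pose A x y := (\sum_w d w * N x w y)%N.
have Au x : A u x = d x.
  rewrite /A (bigD1 x) //= N_unitl eqxx muln1 big1 ?addn0 // => w /negPf wx.
  by rewrite N_unitl wx muln0.
have dA y : (\sum_x d x * A x y = lam * d y)%N.
  rewrite -N_regular; apply: eq_bigr => x _; rewrite big_distrr.
  by apply: eq_bigr => w _; rewrite /= mulnA.
have vA y : (\sum_x v x * A x y = lam * v y)%N.
  transitivity (\sum_x \sum_w d x * d w * \sum_t N z x t * N t w y)%N.
    under eq_bigr do rewrite big_distrlr /=.
    rewrite exchange_big; apply: eq_bigr => x _ /=.
    rewrite exchange_big; apply: eq_bigr => w _ /=.
    by rewrite big_distrr; apply: eq_bigr => t _ /=; rewrite mulnACA.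
  under eq_bigr do under eq_bigr do rewrite N_assoc big_distrr /=.
  under eq_bigr do rewrite exchange_big /=.
  rewrite exchange_big /v big_distrr /=; apply: eq_bigr => t _.
  rewrite mulnA -N_regular big_distrl; apply: eq_bigr => x _ /=.
  by rewrite big_distrl; apply: eq_bigr => w _ /=; rewrite mulnA.
have v0 x : d x = 0%N -> v x = 0%N.
  move=> dx; have /eqP := N_regular x; rewrite dx muln0 sum_nat_eq0 => /forallP/(_ z)/=.
  rewrite sum_nat_eq0 => /forallP vz; apply/eqP; rewrite sum_nat_eq0; apply/forallP => y /=.
  by have /= := vz y; rewrite -mulnA muln_eq0 (gtn_eqF dz).
move=> t; apply/eqP; rewrite -(eqr_nat rat) natrM; apply/eqP.
apply: (@eigenvector_unique O u (fun x y => (A x y)%:R) (fun x => (d x)%:R) lam%:R _ _ _ _ _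
          (fun t => (v t)%:R)) => [x y|x|x||y|y|x].
- exact: ler0n.
- exact: ler0n.
- by rewrite Au.
- by rewrite d_unit.
- by under eq_bigr do rewrite -natrM; rewrite -natr_sum dA natrM.
- by under eq_bigr do rewrite -natrM; rewrite -natr_sum vA natrM.
by move=> /eqP; rewrite (eqr_nat _ _ 0) => /eqP/v0->.
Qed.

End FusionRule.

Section FusionRule2.
Variables (O : finType) (u : O) (N : O -> O -> O -> nat) (d : O -> nat) (lam : nat).
Hypothesis N_assoc : forall x y z t,
  (\sum_w N x y w * N w z t = \sum_w N y z w * N x w t)%N.
Hypothesis N_unitl : forall x y, N u x y = (x == y).
Hypothesis N_unitr : forall x y, N x u y = (x == y).
Hypothesis N_regular : forall z, (\sum_x \sum_y d x * d y * N x y z = lam * d z)%N.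
Hypothesis lam_gt0 : (0 < lam)%N.
Hypothesis d_FP : forall z c (w : O -> nat), (forall j, 0 < w j)%N ->
  (forall j, \sum_i w i * N z i j = c * w j)%N -> d z = c.

Lemma dim_unit : d u = 1%N.
Proof.
apply: (@d_FP u 1%N (fun=> 1%N)) => // j; rewrite (bigD1 j) //= N_unitl eqxx.
by rewrite big1 // => i /negPf ij; rewrite N_unitl ij.
Qed.

(** The opposite fusion rule yields R z = c' R besides z R = c R. [FPdim] is defined by left
    multiplication, so it identifies c directly, and c' through c. *)
Lemma regular_absorb z : (0 < d z)%N ->
  (forall t, \sum_x d x * N z x t = d z * d t)%N /\
  (forall t, \sum_x d x * N x z t = d z * d t)%N.
Proof.
move=> dz; have [c cE] := regular_mulr N_assoc N_unitl N_regular dim_unit dz.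
have [||c' c'E] := @regular_mulr O u (fun x y => N y x) d lam _ N_unitr _ dim_unit z dz.
- by move=> x y z' t; rewrite N_assoc.
- move=> t; rewrite -N_regular exchange_big; apply: eq_bigr => x _; apply: eq_bigr => y _.
  by rewrite (mulnC (d y)).
have dc : d z = c.
  (* The class of R times the sum of all simple elements: left multiplication by z scales it by c,
     and it is positive everywhere because R contains the unit. *)
  pose w t := (\sum_x \sum_y d x * N x y t)%N.
  apply: (@d_FP z c w) => j.
    rewrite /w (bigD1 u) //= (bigD1 j) //= N_unitl eqxx dim_unit.
    by rewrite !addn_gt0.
  transitivity (\sum_x \sum_y d x * \sum_i N x y i * N z i j)%N.
    under eq_bigr do rewrite big_distrl /=.
    rewrite exchange_big; apply: eq_bigr => x _ /=.
    under eq_bigr do rewrite big_distrl /=.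
    rewrite exchange_big; apply: eq_bigr => y _ /=.
    by rewrite big_distrr; apply: eq_bigr => t _ /=; rewrite mulnA.
  under eq_bigr do under eq_bigr do rewrite -N_assoc.
  rewrite exchange_big /w big_distrr [RHS](eq_bigr _ (fun x _ => big_distrr _ _ _)).
  rewrite [RHS]exchange_big /=; apply: eq_bigr => y _.
  under eq_bigr do rewrite big_distrr /=.
  rewrite exchange_big; apply: eq_bigr => i _ /=.
  by rewrite mulnA -cE big_distrl; apply: eq_bigr => x _ /=; rewrite mulnA.
split=> t; first by rewrite cE dc.
(* To see c' = c, compare the multiplicity of the unit in (R z) R = c' R R and in R (z R) = c R R;
   in R R it is lam, which is positive. *)
rewrite c'E dc; congr (_ * _)%N; apply/eqP; rewrite -(eqn_pmul2r lam_gt0); apply/eqP.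
have Nu a : (a * lam = \sum_x \sum_y a * (d x * d y * N x y u))%N.
  by rewrite -[(a * _)%N]muln1 -dim_unit -mulnA -N_regular big_distrr; apply: eq_bigr => x _; rewrite big_distrr.
transitivity (\sum_x \sum_y d x * d y * \sum_s N x z s * N s y u)%N.
  rewrite Nu exchange_big [RHS]exchange_big; apply: eq_bigr => y _ /=.
  under [RHS]eq_bigr do rewrite big_distrr /=.
  rewrite [RHS]exchange_big; apply: eq_bigr => s _ /=.
  rewrite !mulnA -c'E !big_distrl; apply: eq_bigr => x _ /=; ring.
under eq_bigr do under eq_bigr do rewrite N_assoc.
rewrite Nu; apply: eq_bigr => x _.
under eq_bigr do rewrite big_distrr /=.
rewrite exchange_big; apply: eq_bigr => s _ /=.
transitivity (d x * (c * d s) * N x s u)%N; last by ring.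
by rewrite -cE big_distrr big_distrl; apply: eq_bigr => y _ /=; ring.
Qed.

End FusionRule2.

(** * Regular objects *)

Section TensFunctors.
Variables (k : fieldType) (C : monCat k).

Lemma tens_idl_comp (W X Y Z : C) (g : hom Y Z) (f : hom X Y) :
  idm W \om (g \co f) = (idm W \om g) \co (idm W \om f).
Proof. by rewrite -tensm_comp comp_idl. Qed.

Lemma tens_idr_comp (W X Y Z : C) (g : hom Y Z) (f : hom X Y) :
  (g \co f) \om idm W = (g \om idm W) \co (f \om idm W).
Proof. by rewrite -tensm_comp comp_idl. Qed.

Definition tens_functorl (W : C) : linFunctor C C :=
  LinFunctor (fun X Y => @tensm_linr k C W W X Y (idm W)) (@tensm_id k C W) (@tens_idl_comp W).

Definition tens_functorr (W : C) : linFunctor C C :=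
  LinFunctor (fun X Y => @tensm_linl k C X Y W W (idm W)) (fun X => @tensm_id k C X W) (@tens_idr_comp W).

End TensFunctors.

Lemma fhom_iso (k : fieldType) (C C' : linCat k) (H : linFunctor C C') (X Y : C) :
  iso X Y -> iso (H X) (H Y).
Proof.
by move=> f; exists (fhom H f) (fhom H (bwd f)); rewrite -fhom_comp ?bwdK ?fwdK fhom_id.
Qed.

Lemma dim_iso (k : fieldType) (C : linCat k) (w X Y : C) : [pchar k] =i pred0 ->
  iso X Y -> \dim {: hom w X} = \dim {: hom w Y}.
Proof.
move=> k0 f.
pose l (_ : unit) : 'Hom(hom w Y, hom w X) := linfun (fun x => bwd f \co x).
pose r (_ : unit) : 'Hom(hom w X, hom w Y) := linfun (fun x => fwd f \co x).
rewrite (@dim_direct_sum _ _ _ _ l r _ _ k0).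
- by rewrite (big_pred1 tt) //; case.
- by move=> a x; rewrite !(linfunE (comp_linr _)) comp_assoc fwdK comp_idl.
by move=> x; rewrite (big_pred1 tt) ?(linfunE (comp_linr _)) ?comp_assoc ?bwdK ?comp_idl //; case.
Qed.

Section Fusion.
Variables (k : closedFieldType) (C : fusionCat k).
Hypothesis k0 : [pchar k] =i pred0.

Local Notation mult z X := (\dim {: hom (irr z) X}).
Local Notation N x y z := (mult z (irr x \ox irr y)).
Local Notation d x := (fpdim (irr x)).

Lemma mult_tens (t : 'I_(nirr C)) (X Y : C) :
  mult t (X \ox Y) = (\sum_x \sum_y mult x X * mult y Y * N x y t)%N.
Proof.
rewrite (dim_functor (tens_functorr Y) (irr t) X k0); apply: eq_bigr => x _.
rewrite [X in (_ * X)%N](dim_functor (tens_functorl (irr x)) (irr t) Y k0) big_distrr.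
by apply: eq_bigr => y _ /=; rewrite mulnA.
Qed.

Lemma fusion_assoc (x y z t : 'I_(nirr C)) :
  (\sum_w N x y w * N w z t = \sum_w N y z w * N x w t)%N.
Proof.
rewrite -(dim_functor (tens_functorr (irr z)) (irr t) (irr x \ox irr y) k0) /=.
rewrite -(dim_functor (tens_functorl (irr x)) (irr t) (irr y \ox irr z) k0) /=.
exact: dim_iso (assoc _ _ _).
Qed.

Lemma fusion_unit : exists u : 'I_(nirr C),
  (forall x y, N u x y = (x == y)) /\ (forall x y, N x u y = (x == y)).
Proof.
have [u [e]] := irr_surj (funit_simple C); exists u; split=> x y.
  rewrite -(dim_iso _ k0 (fhom_iso (tens_functorr (irr x)) e)) /=.
  by rewrite (dim_iso _ k0 (lunit _)) irr_dim eq_sym.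
rewrite -(dim_iso _ k0 (fhom_iso (tens_functorl (irr x)) e)) /=.
by rewrite (dim_iso _ k0 (runit _)) irr_dim eq_sym.
Qed.

Lemma fpdim_eq (z : 'I_(nirr C)) (c : nat) (w : 'I_(nirr C) -> nat) :
  (forall j, 0 < w j)%N -> (forall j, \sum_i w i * N z i j = c * w j)%N -> d z = c.
Proof.
move=> w0 wN; rewrite /fpdim (_ : FPdim _ = c%:R) ?natrK //.
rewrite /FPdim /eigenvalues; case: closed_field_poly_normal => s /= sE.
apply: (@FP_eigenvalue_eq _ (fusion_matrix (irr z)) (\row_j (w j)%:R)) => [i j|j||||].
- by rewrite mxE ler0n.
- by rewrite mxE ltr0n.
- apply/rowP => j; rewrite !mxE -natrM -wN natr_sum; apply: eq_bigr => i _.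
  by rewrite !mxE natrM.
- by rewrite {1}sE (monicP (char_poly_monic _)) scale1r.
- exact: leq_ltn_trans (ltn_ord z).
exact: ler0n.
Qed.

Lemma fpdim_unit (u : 'I_(nirr C)) : (forall x y, N u x y = (x == y)) -> d u = 1%N.
Proof.
move=> uN; apply: (@dim_unit _ u (fun x y z => N x y z) (fun x => d x)) => // *.
exact: fpdim_eq.
Qed.

End Fusion.

(** * Graded fusion rules and determinants after tensoring with a regular object *)

Section Graded.
Variables (k : closedFieldType) (G : finGroupType) (C : gradedFusion k G).
Hypothesis k0 : [pchar k] =i pred0.

Local Notation mult z X := (\dim {: hom (irr z) X}).
Local Notation N x y z := (mult z (irr x \ox irr y)).
Local Notation d x := (fpdim (irr x)).

Lemma fusion_deg (x y z : 'I_(nirr C)) : (0 < N x y z)%N -> (deg x * deg y)%g = deg z.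
Proof.
rewrite lt0n dimv_eq0 -vpick0 => v0; apply: deg_mul; exists (vpick {: hom (irr z) (irr x \ox irr y)}).
exact: (simple_mono (fabelian C) (irr_simple z) v0).
Qed.

Lemma mult_regular (z : 'I_(nirr C)) (g : G) :
  mult z (regular C g) = ((deg z == g) * d z)%N.
Proof.
rewrite (dim_dirsum _ _ k0).
under eq_bigr do rewrite (dim_dirsum _ _ k0).
rewrite (eq_bigr (fun x => (z == val x) * d (val x))%N); last first.
  by move=> x _; under eq_bigr do rewrite irr_dim; rewrite sum_nat_const card_ord mulnC.
transitivity (\sum_(i < nirr C | deg i == g) (z == i) * d i)%N.
  by symmetry; exact: (big_sub [pred i | deg i == g] (fun i => (z == i) * d i)%N).
rewrite big_mkcond (bigD1 z) //= eqxx big1 => [|i /negPf iz]; last first.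
  by rewrite (eq_sym z) iz mul0n if_same.
by rewrite mul1n addn0; case: eqP; rewrite ?mul1n.
Qed.

Lemma mult_copies (z : 'I_(nirr C)) (I : finType) (X : C) :
  mult z (copies I X) = (#|I| * mult z X)%N.
Proof. by rewrite (dim_dirsum _ _ k0) sum_nat_const. Qed.

(** Absorption into the regular object is proved for simple objects of positive [fpdim]; this
    condition restricts X to them. *)
Definition regularly_supported (X : C) := forall z : 'I_(nirr C), (0 < mult z X)%N -> (0 < d z)%N.

Lemma regularly_supported_copies (I : finType) (g : G) :
  regularly_supported (copies I (regular C g)).
Proof. by move=> z; rewrite mult_copies mult_regular !muln_gt0 => /and3P[]. Qed.

Section Product.
Variable J : regular_mul C.

Lemma regular_rule (f g : G) (z : 'I_(nirr C)) :
  (\sum_(x | deg x == f) \sum_(y | deg y == g) d x * d y * N x y z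
   = gdim C * ((deg z == (f * g)%g) * d z))%N.
Proof.
rewrite -mult_regular -[in RHS](card_ord (gdim C)) -mult_copies -(dim_iso _ k0 (J f g)).
rewrite (mult_tens k0) big_mkcond; apply: eq_bigr => x _ /=.
rewrite big_mkcond; under [RHS]eq_bigr do rewrite !mult_regular.
case: eqP => _; last by rewrite big1 // => y _; rewrite !mul0n.
by apply: eq_bigr => y _; case: eqP; rewrite !mul1n // !mul0n muln0.
Qed.

Lemma gdim_gt0 : (0 < gdim C)%N.
Proof.
have [u [uN Nu]] := fusion_unit C k0.
have du := fpdim_unit uN.
rewrite /gdim (bigD1 u) ?du //=; apply/eqP; apply: (mulgI (deg u)); rewrite mulg1.
by apply: fusion_deg; rewrite uN eqxx.
Qed.

Lemma regular_tens (z : 'I_(nirr C)) : (0 < d z)%N ->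
  (forall t, \sum_x d x * N z x t = d z * d t)%N /\
  (forall t, \sum_x d x * N x z t = d z * d t)%N.
Proof.
have [u [uN Nu]] := fusion_unit C k0.
(* With R the sum of all R_g, each degree is a product f g for exactly |G| pairs, so summing
   [regular_rule] gives R R = |G| D R. *)
apply: (@regular_absorb _ u (fun x y z => N x y z) (fun x => d x) (#|G| * gdim C)) => //.
- by move=> *; apply: fusion_assoc.
- move=> {}z; transitivity (\sum_f \sum_g gdim C * ((deg z == (f * g)%g) * d z))%N.
    under [RHS]eq_bigr do under eq_bigr do rewrite -regular_rule.
    under [RHS]eq_bigr do rewrite exchange_big /=.
    rewrite (partition_big (fun x => deg x) predT) //=; apply: eq_bigr => f _.
    apply: eq_bigr => x _.
    by rewrite (partition_big (fun x => deg x) predT).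
  rewrite -mulnA -sum_nat_const; apply: eq_bigr => f _.
  rewrite -big_distrr /= -big_distrl /=; congr (_ * _)%N.
  rewrite (bigD1 (f^-1 * deg z)%g) //= mulKVg eqxx big1 ?addn0 ?mul1n // => g.
  by rewrite -(inj_eq (mulgI f)) mulKVg eq_sym => /negPf->.
- by rewrite muln_gt0 gdim_gt0 andbT; apply/card_gt0P; exists 1%g.
exact: fpdim_eq.
Qed.

(** Count the unit in R_(g^-1) R_g = D R_e: its multiplicity is D on the right. On the left each z
    of degree g contributes d(z) times the multiplicity of the unit in R z = d(z) R, which is d(z);
    only summands of degree g^-1 matter there. *)
Lemma gdim_component (g : G) : (\sum_(z < nirr C | deg z == g) d z ^ 2 = gdim C)%N.
Proof.
have [u [uN Nu]] := fusion_unit C k0.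
have du := fpdim_unit uN.
have degu : deg u = 1%g.
  by apply: (mulgI (deg u)); rewrite mulg1; apply: fusion_deg; rewrite uN eqxx.
have := regular_rule g^-1 g u; rewrite mulVg degu eqxx du !muln1 => <-.
rewrite exchange_big; apply: eq_bigr => z /eqP zg.
have [->|dz] := posnP (d z); first by rewrite big1 // => x _; rewrite muln0.
have [_ /(_ u)] := regular_tens dz; rewrite du muln1 => dzE.
rewrite expnS expn1 -{1}dzE big_distrl [RHS]big_mkcond /=; apply: eq_bigr => x _.
case: eqP => [_|nx]; first by rewrite mulnAC.
have [->|/fusion_deg] := posnP (N x z u); first by rewrite muln0.
by rewrite zg degu => /(canRL (mulgK _)); rewrite mul1g.
Qed.

Let sum_fpdim (z : 'I_(nirr C)) (M : 'I_(nirr C) -> nat) (g : G) :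
  (forall t, M t = (deg t == g) * (d z * d t))%N ->
  (\sum_t M t * d t = gdim C * d z)%N.
Proof.
move=> ME; rewrite -(gdim_component g) big_distrl [RHS]big_mkcond; apply: eq_bigr => t _ /=.
rewrite ME; case: eqP => _; rewrite ?mul0n // mul1n expnS expn1; ring.
Qed.

(** The part of Z R = d(Z) R in degree deg(Z) h reads Z R_h = d(Z) R_(deg(Z) h), and every R_g has
    dimension D by [gdim_component]; hence the factor D. *)
Lemma det_tensr (h : G) (X : C) (f : hom X X) : regularly_supported X ->
  det_aut (f \om idm (regular C h)) = det_aut f ^+ gdim C.
Proof.
move=> suppX; apply: (@det_aut_functor _ _ _ (tens_functorr (regular C h))) => z /suppX dz.
apply: (@sum_fpdim _ _ (deg z * h)%g) => t.
rewrite [LHS](dim_functor (tens_functorl (irr z)) _ _ k0) /=.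
have [/(_ t) <- _] := regular_tens dz; rewrite big_distrr; apply: eq_bigr => x _.
rewrite mult_regular /=.
have [->|/fusion_deg Nx] := posnP (N z x t); first by rewrite !muln0.
by rewrite -Nx (inj_eq (mulgI _)) mulnA.
Qed.

Lemma det_tensl (h : G) (X : C) (f : hom X X) : regularly_supported X ->
  det_aut (idm (regular C h) \om f) = det_aut f ^+ gdim C.
Proof.
move=> suppX; apply: (@det_aut_functor _ _ _ (tens_functorl (regular C h))) => z /suppX dz.
apply: (@sum_fpdim _ _ (h * deg z)%g) => t.
rewrite [LHS](dim_functor (tens_functorr (irr z)) _ _ k0) /=.
have [_ /(_ t) <-] := regular_tens dz; rewrite big_distrr; apply: eq_bigr => x _.
rewrite mult_regular /=.
have [->|/fusion_deg Nx] := posnP (N x z t); first by rewrite !muln0.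
by rewrite -Nx (inj_eq (mulIg _)) mulnA.
Qed.

End Product.
End Graded.

(** * Matrices of endomorphisms *)

Section Frames.
Variables (k : fieldType) (C : linCat k).

(** This presents Y as a direct sum of copies of X with Y left as it is: iterated tensor products
    are not the chosen sums. *)
Definition is_frame (X Y : C) (I : finType) (v : I -> hom X Y) (p : I -> hom Y X) : Prop :=
  (forall i j, p i \co v j = (i == j)%:R *: idm X) /\ \sum_i v i \co p i = idm Y.

Lemma frame_comp (X Y Z : C) (I J : finType) (v : I -> hom X Y) p (v' : J -> hom Y Z) p' :
  is_frame v p -> is_frame v' p' ->
  is_frame (fun a : J * I => v' a.1 \co v a.2) (fun a => p a.2 \co p' a.1).
Proof.
move=> [pv vp] [pv' vp']; split=> [[j i] [j' i']|] /=.
  rewrite comp_assoc -(comp_assoc (p i)) pv' compZr compZl comp_idr pv scalerA -natrM mulnb.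
  by rewrite xpair_eqE.
rewrite -(pair_big predT predT (fun j i => v' j \co v i \co (p i \co p' j))) /= -vp'.
apply: eq_bigr => j _; rewrite -[v' j in RHS]comp_idr -vp comp_sumr comp_suml.
by apply: eq_bigr => i _; rewrite !comp_assoc.
Qed.

Lemma frame_reindex (X Y : C) (I J : finType) (v : I -> hom X Y) p (h : J -> I) :
  bijective h -> is_frame v p -> is_frame (fun j => v (h j)) (fun j => p (h j)).
Proof.
move=> bh [pv vp]; split=> [i j|]; first by rewrite pv (bij_eq bh).
by rewrite -vp [RHS](reindex h) //; apply: onW_bij.
Qed.

Lemma frame_dirsum (I : finType) (X : C) (S : dirsum (fun _ : I => X)) :
  is_frame (fun i => inj S i) (fun i => proj S i).
Proof.
split=> [i j|]; last exact: sum_inj_proj.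
have [->|ij] := eqVneq i j; first by rewrite proj_inj scale1r.
by rewrite proj_inj0 ?scale0r // eq_sym.
Qed.

Lemma frame_iso (X X' Y Y' : C) (I : finType) (v : I -> hom X Y) p (a : iso X X') (b : iso Y Y') :
  is_frame v p ->
  is_frame (fun i => b \co v i \co bwd a) (fun i => a \co p i \co bwd b).
Proof.
move=> [pv vp]; split=> [i j|].
  rewrite !comp_assoc -(comp_assoc _ (bwd b)) bwdK comp_idr -(comp_assoc _ (p i)) pv.
  by rewrite compZr compZl comp_idr fwdK.
rewrite -(fwdK b) -[fwd b in RHS]comp_idr -vp comp_sumr comp_suml; apply: eq_bigr => i _.
by rewrite !comp_assoc -(comp_assoc _ (bwd a)) bwdK comp_idr.
Qed.

End Frames.

Lemma frame_functor (k : fieldType) (C C' : linCat k) (H : linFunctor C C') (X Y : C) (I : finType)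
    (v : I -> hom X Y) p :
  is_frame v p -> is_frame (fun i => fhom H (v i)) (fun i => fhom H (p i)).
Proof.
move=> [pv vp]; split=> [i j|].
  by rewrite -fhom_comp pv (linZ (@fhom_lin _ _ _ H _ _)) fhom_id.
rewrite -fhom_id -vp (linsum (@fhom_lin _ _ _ H _ _)).
by apply: eq_bigr => i _; rewrite fhom_comp.
Qed.

(** * Scalar determinants of matrices over an endomorphism ring *)

Section MatrixDet.
Variables (k : closedFieldType) (C : fusionCat k).
Hypothesis k0 : [pchar k] =i pred0.

Definition mx_hom (I : finType) (X : C) (M : I -> I -> hom X X) : hom (copies I X) (copies I X) :=
  \sum_i \sum_j inj (copies I X) i \co M i j \co proj (copies I X) j.

(** End(X) need not be commutative, so the determinant is taken of the endomorphism of the sum of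
    copies that the matrix defines. *)
Definition mx_det (I : finType) (X : C) (M : I -> I -> hom X X) : k := det_aut (mx_hom M).

Lemma mx_hom_frame (X Y : C) (I : finType) (v : I -> hom X Y) (p : I -> hom Y X) (f : hom Y Y) :
  mx_hom (fun i j => p i \co f \co v j) =
  (\sum_i inj (copies I X) i \co p i) \co f \co (\sum_i v i \co proj (copies I X) i).
Proof.
rewrite 2!comp_suml; apply: eq_bigr => i _; rewrite comp_sumr.
by apply: eq_bigr => j _; rewrite !comp_assoc.
Qed.

Lemma det_aut_frame (X Y : C) (I : finType) (v : I -> hom X Y) p (f : hom Y Y) :
  is_frame v p -> det_aut f = mx_det (fun i j => p i \co f \co v j).
Proof.
move=> vpF; rewrite /mx_det mx_hom_frame det_aut_conj //.
- have [_ vp] := vpF; rewrite -vp comp_suml; apply: eq_bigr => i _.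
  have [pi _] := frame_dirsum (copies I X).
  rewrite comp_sumr (bigD1 i) //= big1 ?addr0 => [|j /negPf ij].
    by rewrite comp_assoc -(comp_assoc (v i)) pi eqxx scale1r comp_idr.
  by rewrite comp_assoc -(comp_assoc (v i)) pi eq_sym ij scale0r comp0r comp0l.
have [pv _] := vpF; rewrite -(sum_inj_proj (copies I X)) comp_suml; apply: eq_bigr => i _.
rewrite comp_sumr (bigD1 i) //= big1 ?addr0 => [|j /negPf ij].
  by rewrite comp_assoc -(comp_assoc (inj _ i)) pv eqxx scale1r comp_idr.
by rewrite comp_assoc -(comp_assoc (inj _ i)) pv eq_sym ij scale0r comp0r comp0l.
Qed.

Lemma eq_mx_det (I : finType) (X : C) (M M' : I -> I -> hom X X) :
  (forall i j, M i j = M' i j) -> mx_det M = mx_det M'.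
Proof.
by move=> MM; congr det_aut; apply: eq_bigr => i _; apply: eq_bigr => j _; rewrite MM.
Qed.

Lemma mx_homK (I : finType) (X : C) (M : I -> I -> hom X X) i j :
  proj (copies I X) i \co mx_hom M \co inj (copies I X) j = M i j.
Proof.
have [pi _] := frame_dirsum (copies I X).
rewrite comp_sumr comp_suml (bigD1 i) //= [X in _ + X]big1 ?addr0 => [|i' /negPf ii].
  rewrite comp_sumr comp_suml (bigD1 j) //= [X in _ + X]big1 ?addr0 => [|j' /negPf jj].
    rewrite !comp_assoc pi -comp_assoc pi !eqxx !scale1r comp_idr comp_idl //.
  by rewrite !comp_assoc -comp_assoc (pi j') jj scale0r comp0r.
by rewrite comp_sumr comp_suml big1 // => j' _; rewrite !comp_assoc pi eq_sym ii scale0r !comp0l.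
Qed.

Lemma mx_hom_eta (I : finType) (X : C) (f : hom (copies I X) (copies I X)) :
  f = mx_hom (fun i j => proj (copies I X) i \co f \co inj (copies I X) j).
Proof.
by rewrite mx_hom_frame (sum_inj_proj (copies I X)) comp_idl comp_idr.
Qed.

Lemma mx_homM (I : finType) (X : C) (M M' : I -> I -> hom X X) :
  mx_hom M \co mx_hom M' = mx_hom (fun i j => \sum_l M i l \co M' l j).
Proof.
rewrite [LHS]mx_hom_eta; apply: eq_bigr => i _; apply: eq_bigr => j _; congr (_ \co _ \co _).
rewrite -[mx_hom M]comp_idr -(sum_inj_proj (copies I X)) comp_sumr comp_suml comp_sumr comp_suml.
apply: eq_bigr => l _; rewrite -[M i l]mx_homK -[M' l j]mx_homK.
by rewrite !comp_assoc.
Qed.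

(** Inserting the identity of Y' resolved by the frame turns the composite into a matrix product.
    The two factors may relate different objects, as the edges of the pentagon do. *)
Lemma mx_det_comp (X Y Y' Y'' : C) (I : finType) (v : I -> hom X Y)
    (v' : I -> hom X Y') p' (p'' : I -> hom Y'' X) (f : hom Y Y') (g : hom Y' Y'') :
  is_frame v' p' ->
  mx_det (fun i j => p'' i \co (g \co f) \co v j) =
  mx_det (fun i j => p'' i \co g \co v' j) * mx_det (fun i j => p' i \co f \co v j).
Proof.
move=> [_ vp]; rewrite /mx_det -det_autM mx_homM; apply: eq_mx_det => i j.
rewrite -[g]comp_idr -[in LHS]vp comp_sumr comp_suml comp_sumr comp_suml.
by apply: eq_bigr => l _; rewrite comp_idr !comp_assoc.
Qed.

Lemma mx_det1 (I : finType) (X Y : C) (v : I -> hom X Y) p :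
  is_frame v p -> mx_det (fun i j => p i \co v j) = 1.
Proof.
move=> vpF; rewrite -(det_aut1 Y) (det_aut_frame _ vpF).
by apply: eq_mx_det => i j; rewrite comp_idr.
Qed.

Lemma mx_det_reindex (I J : finType) (h : J -> I) (X : C) (M : I -> I -> hom X X) :
  bijective h -> mx_det (fun i j => M (h i) (h j)) = mx_det M.
Proof.
move=> bh; rewrite [RHS](det_aut_frame _ (frame_reindex bh (frame_dirsum (copies I X)))).
by apply: eq_mx_det => i j; rewrite mx_homK.
Qed.

Definition copies_hom (I : finType) (X Y : C) (f : hom X Y) : hom (copies I X) (copies I Y) :=
  \sum_i inj (copies I Y) i \co f \co proj (copies I X) i.

Lemma copies_hom_lin (I : finType) (X Y : C) : linear (@copies_hom I X Y).
Proof.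
move=> c f g; rewrite scaler_sumr -big_split; apply: eq_bigr => i _ /=.
by rewrite compDr compZr compDl compZl.
Qed.

Lemma copies_hom_id (I : finType) (X : C) : copies_hom I (idm X) = idm (copies I X).
Proof.
by rewrite -(sum_inj_proj (copies I X)); apply: eq_bigr => i _; rewrite comp_idr.
Qed.

Lemma copies_hom_comp (I : finType) (X Y Z : C) (g : hom Y Z) (f : hom X Y) :
  copies_hom I (g \co f) = copies_hom I g \co copies_hom I f.
Proof.
rewrite comp_suml; apply: eq_bigr => i _.
rewrite comp_sumr (bigD1 i) //= [X in _ + X]big1 ?addr0 => [|j ji].
  by rewrite !comp_assoc -(comp_assoc _ (proj _ i)) proj_inj comp_idr.
by rewrite !comp_assoc -(comp_assoc _ (proj _ i)) proj_inj0 // comp0r !comp0l.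
Qed.

Definition copies_functor (I : finType) : linFunctor C C :=
  LinFunctor (@copies_hom_lin I) (copies_hom_id I) (@copies_hom_comp I).

(** A block diagonal matrix with equal blocks is the image of one block under the functor of |I|
    copies, which multiplies dimensions by |I|. The bijection h selects which part of the index
    labels the block. *)
Lemma mx_det_diag (I J L : finType) (h : L -> I * J) (X : C) (M : J -> J -> hom X X) :
  bijective h ->
  mx_det (fun l l' => ((h l).1 == (h l').1)%:R *: M (h l).2 (h l').2) = mx_det M ^+ #|I|.
Proof.
move=> bh; rewrite (mx_det_reindex (fun a b => (a.1 == b.1)%:R *: M a.2 b.2) bh).
rewrite /mx_det -(@det_aut_functor _ _ _ (copies_functor I)) => [|z _]; last first.
  under eq_bigr do rewrite (dim_dirsum _ _ k0) sum_nat_const irr_dim -mulnA.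
  rewrite -big_distrr (bigD1 z) //= eqxx mul1n big1 ?addn0 // => i /negPf->.
  by rewrite mul0n.
have F := frame_comp (frame_dirsum (copies J X)) (frame_dirsum (copies I (copies J X))).
rewrite (det_aut_frame _ F); apply: eq_mx_det => -[i j] [i' j'] /=.
rewrite comp_sumr comp_suml (bigD1 i) //= [X in _ + X]big1 ?addr0 => [|l il].
  have [pi _] := frame_dirsum (copies I (copies J X)).
  rewrite !comp_assoc -(comp_assoc _ (proj _ i) (inj _ i)) pi eqxx scale1r comp_idr.
  rewrite -!comp_assoc (comp_assoc (proj _ i)) pi compZl comp_idl !compZr.
  by rewrite comp_assoc mx_homK.
by rewrite !comp_assoc -(comp_assoc _ (proj _ i) (inj _ l)) proj_inj0 // comp0r !comp0l.
Qed.

End MatrixDet.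

(** * The pentagon *)

(* The unknown [x] with a proof of [f * g = x] avoids transports along the
   associativity of G. *)
Record mult_frame (k : fieldType) (G : finGroupType) (C : monCat k) (R : G -> C) (n : nat) :=
  MultFrame {
  mi : forall f g x : G, (f * g)%g = x -> 'I_n -> hom (R x) (R f \ox R g);
  mp : forall f g x : G, (f * g)%g = x -> 'I_n -> hom (R f \ox R g) (R x);
  mult_frameP : forall f g x (e : (f * g)%g = x), is_frame (mi e) (mp e) }.

Section Associator.
Variables (k : closedFieldType) (G : finGroupType) (C : gradedFusion k G).
Hypothesis k0 : [pchar k] =i pred0.
Variable J : regular_mul C.
Local Notation R := (regular C).

Section OneFrame.
Variables (n : nat) (m : mult_frame R n).
Local Notation mi := (mi m).
Local Notation mp := (mp m).
Implicit Types p q : 'I_n * 'I_n.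

Section Triple.
Variables (f g h u w x : G) (e1 : (f * g)%g = u) (e2 : (u * h)%g = x)
  (e3 : (g * h)%g = w) (e4 : (f * w)%g = x).

Definition inl3 q : hom (R x) (R f \ox R g \ox R h) :=
  (mi e1 q.1 \om idm (R h)) \co mi e2 q.2.
Definition prl3 q : hom (R f \ox R g \ox R h) (R x) :=
  mp e2 q.2 \co (mp e1 q.1 \om idm (R h)).
Definition inr3 p : hom (R x) (R f \ox (R g \ox R h)) :=
  (idm (R f) \om mi e3 p.2) \co mi e4 p.1.
Definition prr3 p : hom (R f \ox (R g \ox R h)) (R x) :=
  mp e4 p.1 \co (idm (R f) \om mp e3 p.2).

Lemma frame_l3 : is_frame inl3 prl3.
Proof.
exact: frame_comp (mult_frameP m e2) (frame_functor (tens_functorr (R h)) (mult_frameP m e1)).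
Qed.

Lemma frame_r3 : is_frame inr3 prr3.
Proof.
have := frame_comp (mult_frameP m e4) (frame_functor (tens_functorl (R f)) (mult_frameP m e3)).
(* [frame_comp] puts the index of R_g (x) R_h first; the exchange restores the order of
   [triple_right]. *)
by apply: (frame_reindex (h := fun p => (p.2, p.1))); exists (fun p => (p.2, p.1)); case.
Qed.

Definition assoc_mx p q : hom (R x) (R x) :=
  prr3 p \co assoc (R f) (R g) (R h) \co inl3 q.

Lemma assoc_mx_det_neq0 : mx_det assoc_mx != 0.
Proof.
pose a := assoc (R f) (R g) (R h).
have : mx_det (fun p q => prl3 p \co (bwd a \co fwd a) \co inl3 q) = 1.
  rewrite -(mx_det1 frame_l3); apply: eq_mx_det => p q.
  by rewrite bwdK comp_idr.
rewrite (mx_det_comp _ _ _ _ frame_r3) => E.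
by apply: contra_eq_neq E => ->; rewrite mulr0 eq_sym oner_neq0.
Qed.

End Triple.

Definition assoc_det f g h : k :=
  mx_det (assoc_mx erefl erefl erefl (mulgA f g h)).

Lemma assoc_detE f g h u w x (e1 : (f * g)%g = u) (e2 : (u * h)%g = x)
    (e3 : (g * h)%g = w) (e4 : (f * w)%g = x) :
  mx_det (assoc_mx e1 e2 e3 e4) = assoc_det f g h.
Proof. by subst u w x; rewrite (eq_irrelevance e4 (mulgA f g h)). Qed.

(** The left side is the matrix of [mx_hom M] tensored with R_h, in the frame obtained by splitting
    first the product R_x R_h and then the copies. *)
Lemma mx_det_tensr (I : finType) (x h y : G) (e : (x * h)%g = y) (M : I -> I -> hom (R x) (R x)) :
  mx_det (fun p q : I * 'I_n => mp e p.2 \co (M p.1 q.1 \om idm (R h)) \co mi e q.2)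
  = mx_det M ^+ gdim C.
Proof.
rewrite -(det_tensr k0 J h _ (regularly_supported_copies k0 (I := I) (g := x))).
have F := frame_comp (mult_frameP m e)
  (frame_functor (tens_functorr (R h)) (frame_dirsum (copies I (R x)))).
rewrite (det_aut_frame _ F); apply: eq_mx_det => -[i a] [j b] /=.
by rewrite -(mx_homK M) !tens_idr_comp !comp_assoc.
Qed.

Lemma mx_det_tensl (I : finType) (x h y : G) (e : (h * x)%g = y) (M : I -> I -> hom (R x) (R x)) :
  mx_det (fun p q : I * 'I_n => mp e p.2 \co (idm (R h) \om M p.1 q.1) \co mi e q.2)
  = mx_det M ^+ gdim C.
Proof.
rewrite -(det_tensl k0 J h _ (regularly_supported_copies k0 (I := I) (g := x))).
have F := frame_comp (mult_frameP m e)
  (frame_functor (tens_functorl (R h)) (frame_dirsum (copies I (R x)))).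
rewrite (det_aut_frame _ F); apply: eq_mx_det => -[i a] [j b] /=.
by rewrite -(mx_homK M) !tens_idl_comp !comp_assoc.
Qed.

Lemma assoc_natl (X X' Y Z : C) (f : hom X X') :
  assoc X' Y Z \co ((f \om idm Y) \om idm Z) = (f \om idm (Y \ox Z)) \co assoc X Y Z.
Proof. by rewrite assoc_nat tensm_id. Qed.

Lemma assoc_natm (X Y Y' Z : C) (f : hom Y Y') :
  assoc X Y' Z \co ((idm X \om f) \om idm Z) = (idm X \om (f \om idm Z)) \co assoc X Y Z.
Proof. by rewrite assoc_nat. Qed.

Lemma assoc_natr (X Y Z Z' : C) (f : hom Z Z') :
  assoc X Y Z' \co (idm (X \ox Y) \om f) = (idm X \om (idm Y \om f)) \co assoc X Y Z.
Proof. by rewrite -assoc_nat tensm_id. Qed.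

Lemma tensm_swap (X X' Y Y' : C) (f : hom X X') (g : hom Y Y') :
  (f \om idm Y') \co (idm X \om g) = (idm X' \om g) \co (f \om idm Y).
Proof. by rewrite -!tensm_comp !comp_idl !comp_idr. Qed.

Section Pentagon.
Variables (f g h l u v w x y z : G).
Hypotheses (fg : (f * g)%g = u) (gh : (g * h)%g = v) (hl : (h * l)%g = w)
  (uh : (u * h)%g = x) (fv : (f * v)%g = x) (vl : (v * l)%g = y) (gw : (g * w)%g = y)
  (xl : (x * l)%g = z) (uw : (u * w)%g = z) (fy : (f * y)%g = z).
Local Notation K := ('I_n * 'I_n * 'I_n)%type.

(* At each vertex of the pentagon, rows and columns are indexed by K in such an
   order that every edge leaves its passive index in place; the opposite
   convention would introduce signs. *)

Let v1 (i : K) := (inl3 fg uh i.1 \om idm (R l)) \co mi xl i.2.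
Let p1 (i : K) := mp xl i.2 \co (prl3 fg uh i.1 \om idm (R l)).
Let v4 (i : K) := (inr3 gh fv i.1 \om idm (R l)) \co mi xl i.2.
Let p4 (i : K) := mp xl i.2 \co (prr3 gh fv i.1 \om idm (R l)).
Let v5 (i : K) := (idm (R f) \om inl3 gh vl (i.1.2, i.2)) \co mi fy i.1.1.
Let p5 (i : K) := mp fy i.1.1 \co (idm (R f) \om prl3 gh vl (i.1.2, i.2)).
Let p3 (i : K) := mp fy i.1.1 \co (idm (R f) \om prr3 hl gw (i.1.2, i.2)).
Let v2 (i : K) := (mi fg i.1.1 \om idm (R h \ox R l)) \co inr3 hl uw (i.1.2, i.2).
Let p2 (i : K) := prr3 hl uw (i.1.2, i.2) \co (mp fg i.1.1 \om idm (R h \ox R l)).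

Let F4 : is_frame v4 p4.
Proof.
exact: frame_comp (mult_frameP m xl) (frame_functor (tens_functorr (R l)) (frame_r3 gh fv)).
Qed.

Let rot (i : K) : K := (i.1.2, i.2, i.1.1).
Let rot_bij : bijective rot.
Proof. by exists (fun i => (i.2, i.1.1, i.1.2)) => -[[]]. Qed.

Let F5 : is_frame v5 p5.
Proof.
have := frame_comp (mult_frameP m fy) (frame_functor (tens_functorl (R f)) (frame_l3 gh vl)).
exact: frame_reindex rot_bij.
Qed.

Let F2 : is_frame v2 p2.
Proof.
have := frame_comp (frame_r3 hl uw) (frame_functor (tens_functorr (R h \ox R l)) (mult_frameP m fg)).
apply: (frame_reindex (h := fun i : K => (i.1.1, (i.1.2, i.2)))).
by exists (fun i => (i.1, i.2.1, i.2.2)) => [[[]]|[? []]].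
Qed.

(** The passive index is that of [fg]. Naturality of the associator in its first variable brings
    [mp fg] next to [mi fg], and their composite is the delta of a block diagonal matrix. [left2]
    and [right2] use the third and the second variable, with passive indices [hl] and [gh]. *)
Let left1 : mx_det (fun i j => p2 i \co assoc (R f \ox R g) (R h) (R l) \co v1 j)
  = assoc_det u h l ^+ n.
Proof.
rewrite -(assoc_detE uh xl hl uw) -[X in _ = _ ^+ X]card_ord.
rewrite -(@mx_det_diag _ _ k0 _ _ K (fun i => (i.1.1, (i.1.2, i.2)))); last first.
  by exists (fun i => (i.1, i.2.1, i.2.2)) => [[[]]|[? []]].
apply: eq_mx_det => -[[c p] q] [[c' d] e] /=.
rewrite /p2 /v1 /inl3 /= tens_idr_comp.
rewrite !comp_assoc -(comp_assoc _ (fwd _)) assoc_natl.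
rewrite comp_assoc -(comp_assoc _ (mp fg c \om _)) -tens_idr_comp (mult_frameP m fg).1.
rewrite (linZ (tensm_linl _)) tensm_id compZr !compZl comp_idr.
by rewrite /assoc_mx /inl3 !comp_assoc.
Qed.

Let left2 : mx_det (fun i j => p3 i \co assoc (R f) (R g) (R h \ox R l) \co v2 j)
  = assoc_det f g w ^+ n.
Proof.
rewrite -(assoc_detE fg uw gw fy) -[X in _ = _ ^+ X]card_ord.
rewrite -(@mx_det_diag _ _ k0 _ _ K (fun i => (i.2, (i.1.1, i.1.2)))); last first.
  by exists (fun i => (i.2.1, i.2.2, i.1)) => [[[]]|[? []]].
apply: eq_mx_det => -[[r s] q] [[c p] q'] /=.
rewrite /p3 /v2 /inr3 /prr3 /= !comp_assoc -(comp_assoc _ (_ \om _) (_ \om mi hl q')).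
rewrite tensm_swap comp_assoc -(comp_assoc _ (fwd _)) assoc_natr.
rewrite tens_idl_comp !comp_assoc -(comp_assoc _ (_ \om (_ \om mp hl q))).
rewrite -!tens_idl_comp (mult_frameP m hl).1.
rewrite (linZ (tensm_linr _)) tensm_id (linZ (tensm_linr _)) tensm_id.
by rewrite compZr !compZl comp_idr /assoc_mx /inl3 !comp_assoc.
Qed.

Let right1 : mx_det (fun i j => p4 i \co (assoc (R f) (R g) (R h) \om idm (R l)) \co v1 j)
  = assoc_det f g h ^+ gdim C.
Proof.
rewrite -(assoc_detE fg uh gh fv) -(mx_det_tensr xl).
by apply: eq_mx_det => -[p a] [q b]; rewrite /p4 /v1 /= !tens_idr_comp !comp_assoc.
Qed.

Let right2 : mx_det (fun i j => p5 i \co assoc (R f) (R g \ox R h) (R l) \co v4 j)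
  = assoc_det f v l ^+ n.
Proof.
rewrite -(assoc_detE fv xl vl fy) -[X in _ = _ ^+ X]card_ord.
rewrite -(@mx_det_diag _ _ k0 _ _ K (fun i => (i.1.2, (i.1.1, i.2)))); last first.
  by exists (fun i => (i.2.1, i.1, i.2.2)) => [[[]]|[? []]].
apply: eq_mx_det => -[[r b] t] [[a b'] e] /=.
rewrite /p5 /v4 /inr3 /prl3 /= tens_idr_comp !comp_assoc -(comp_assoc _ (fwd _)) assoc_natm.
rewrite tens_idl_comp !comp_assoc -(comp_assoc _ (_ \om (mp gh b \om _))).
rewrite -tens_idl_comp -tens_idr_comp (mult_frameP m gh).1.
rewrite (linZ (tensm_linl _)) tensm_id (linZ (tensm_linr _)) tensm_id.
by rewrite compZr !compZl comp_idr /assoc_mx /inl3 /prr3 !comp_assoc.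
Qed.

Let right3 : mx_det (fun i j => p3 i \co (idm (R f) \om assoc (R g) (R h) (R l)) \co v5 j)
  = assoc_det g h l ^+ gdim C.
Proof.
rewrite -(assoc_detE gh vl hl gw) -(mx_det_tensl fy).
rewrite -[RHS](mx_det_reindex _ rot_bij).
by apply: eq_mx_det => -[[p a] c] [[q b] d] ; rewrite /p3 /v5 /= !tens_idl_comp !comp_assoc.
Qed.

(** The two edges with an associator tensored with an identity get [gdim C] as exponent, the three
    with a passive index get [n]. *)
Lemma assoc_det_pentagon :
  assoc_det g h l ^+ gdim C * assoc_det f v l ^+ n * assoc_det f g h ^+ gdim C =
  assoc_det u h l ^+ n * assoc_det f g w ^+ n.
Proof.
rewrite -left1 -left2 -right1 -right2 -right3 -(mx_det_comp _ _ _ _ F5) -(mx_det_comp _ _ _ _ F4).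
rewrite mulrC -(mx_det_comp _ _ _ _ F2); apply: eq_mx_det => i j.
by rewrite pentagon.
Qed.

End Pentagon.

Lemma assoc_det_cocycle : n = gdim C -> is_3cocycle (fun f g h => assoc_det f g h ^+ n).
Proof.
move=> nD; split=> [f g h|f g h l]; first by rewrite expf_neq0 // assoc_mx_det_neq0.
have := @assoc_det_pentagon f g h l _ _ _ _ _ _ erefl erefl erefl erefl (mulgA _ _ _)
  erefl (mulgA _ _ _) erefl _ _.
rewrite -nD; apply.
  by rewrite !mulgA.
by rewrite !mulgA.
Qed.

End OneFrame.
End Associator.

(** * Change of identifications *)

Section RegularFrame.
Variables (k : closedFieldType) (G : finGroupType) (C : gradedFusion k G) (J : regular_mul C).

Lemma regular_frameP (f g x : G) (e : (f * g)%g = x) :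
  is_frame (fun a => minj J f g a \co hom_of_eq (congr1 (regular C) (esym e)))
           (fun a => hom_of_eq (congr1 (regular C) e) \co mproj J f g a).
Proof.
subst x; split=> [a b|] /=.
  rewrite comp_idl comp_idr /minj /mproj !comp_assoc -(comp_assoc _ (fwd _)) fwdK comp_idr.
  exact: (frame_dirsum (copies 'I_(gdim C) (regular C (f * g)%g))).1.
rewrite -(bwdK (J f g)) -[fwd (J f g) in RHS]comp_idl.
rewrite -(sum_inj_proj (copies 'I_(gdim C) (regular C (f * g)%g))) comp_suml comp_sumr.
by apply: eq_bigr => a _; rewrite comp_idl comp_idr /minj /mproj !comp_assoc.
Qed.

Definition regular_frame : mult_frame (regular C) (gdim C) := MultFrame regular_frameP.

Lemma alphaCE (f g h : G) : alphaC J f g h = assoc_det regular_frame f g h ^+ gdim C.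
Proof.
rewrite /alphaC /assoc_det /mx_det; congr (det_aut _ ^+ _).
rewrite /regular_assoc /triple_right /triple_left -comp_assoc comp_suml; apply: eq_bigr => p _.
rewrite !comp_sumr; apply: eq_bigr => q _.
by rewrite /assoc_mx /prr3 /inl3 /= !comp_idr !comp_idl !comp_assoc.
Qed.

End RegularFrame.

Section Comparison.
Variables (k : closedFieldType) (G : finGroupType) (C : gradedFusion k G).
Hypothesis k0 : [pchar k] =i pred0.
Variables (J : regular_mul C) (n : nat) (m m' : mult_frame (regular C) n).
Local Notation R := (regular C).

Definition change_mx (f g x : G) (e : (f * g)%g = x) (a b : 'I_n) : hom (R x) (R x) :=
  mp m' e a \co mi m e b.

Definition change_det f g : k := mx_det (change_mx (erefl (f * g)%g)).

Lemma change_detE f g x (e : (f * g)%g = x) : mx_det (change_mx e) = change_det f g.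
Proof. by subst x. Qed.

Lemma change_det_neq0 f g : change_det f g != 0.
Proof.
have : mx_det (fun a b => mp m (erefl (f * g)%g) a \co (idm _ \co idm _) \co mi m erefl b) = 1.
  rewrite -(mx_det1 (mult_frameP m (erefl (f * g)%g))); apply: eq_mx_det => a b.
  by rewrite !comp_idr.
rewrite (mx_det_comp _ _ _ _ (mult_frameP m' erefl)) => E; apply: contra_eq_neq E => c0.
rewrite [X in _ * X](_ : _ = 0) ?mulr0 1?eq_sym ?oner_neq0 // -[RHS]c0.
by apply: eq_mx_det => a b; rewrite comp_idr.
Qed.

(** Both sides are the determinant of the associator with frames from [m] at its source and from
    [m'] at its target; the frames are changed at the source on the left, at the target on the
    right. *)
Lemma assoc_det_change f g h :
  assoc_det m' f g h * (change_det (f * g)%g h ^+ n * change_det f g ^+ gdim C) =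
  change_det f (g * h)%g ^+ n * change_det g h ^+ gdim C * assoc_det m f g h.
Proof.
pose e1 := erefl (f * g)%g; pose e2 := erefl (f * g * h)%g; pose e3 := erefl (g * h)%g.
have e4 : (f * (g * h) = f * g * h)%g by rewrite mulgA.
(* A mixed frame, [m'] for the inner product and [m] for the outer one, splits the change in two:
   changing the outer product leaves the inner index passive, and changing the inner one is tensored
   with R_h. *)
pose vl q := (mi m' e1 q.1 \om idm (R h)) \co mi m e2 q.2.
pose pl q := mp m e2 q.2 \co (mp m' e1 q.1 \om idm (R h)).
have Fl : is_frame vl pl.
  exact: frame_comp (mult_frameP m e2) (frame_functor (tens_functorr (R h)) (mult_frameP m' e1)).
pose vr p := (idm (R f) \om mi m' e3 p.2) \co mi m e4 p.1.
pose pr p := mp m e4 p.1 \co (idm (R f) \om mp m' e3 p.2).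
have Fr : is_frame vr pr.
  have := frame_comp (mult_frameP m e4) (frame_functor (tens_functorl (R f)) (mult_frameP m' e3)).
  by apply: (frame_reindex (h := fun p => (p.2, p.1))); exists (fun p => (p.2, p.1)); case.
have swap_bij : bijective (fun p : 'I_n * 'I_n => (p.2, p.1)) by exists (fun p => (p.2, p.1)); case.
have El : mx_det (fun p q => prl3 m' e1 e2 p \co idm _ \co inl3 m e1 e2 q)
    = change_det (f * g)%g h ^+ n * change_det f g ^+ gdim C.
  transitivity (mx_det (fun p q => prl3 m' e1 e2 p \co (idm _ \co idm _) \co inl3 m e1 e2 q)).
    by apply: eq_mx_det => p q; rewrite comp_idl.
  rewrite (mx_det_comp _ _ _ _ Fl); congr (_ * _).
    rewrite -[X in _ ^+ X]card_ord -(@mx_det_diag _ _ k0 _ _ _ id); last by exists id.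
    apply: eq_mx_det => -[c d] [c' d']; rewrite /prl3 /vl /= comp_idr !comp_assoc.
    rewrite -(comp_assoc _ (mp m' e1 c \om _)) -tens_idr_comp (mult_frameP m' e1).1.
    by rewrite (linZ (tensm_linl _)) tensm_id compZr compZl comp_idr.
  rewrite -(mx_det_tensr k0 J m e2); apply: eq_mx_det => -[c d] [c' d'] /=.
  by rewrite /pl /inl3 /= comp_idr !comp_assoc tens_idr_comp !comp_assoc.
have Er : mx_det (fun p q => prr3 m' e3 e4 p \co idm _ \co inr3 m e3 e4 q)
    = change_det f (g * h)%g ^+ n * change_det g h ^+ gdim C.
  transitivity (mx_det (fun p q => prr3 m' e3 e4 p \co (idm _ \co idm _) \co inr3 m e3 e4 q)).
    by apply: eq_mx_det => p q; rewrite comp_idl.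
  rewrite (mx_det_comp _ _ _ _ Fr); congr (_ * _).
    rewrite -(change_detE e4) -[X in _ ^+ X]card_ord -(mx_det_diag k0 _ swap_bij).
    apply: eq_mx_det => -[c d] [c' d']; rewrite /prr3 /vr /= comp_idr !comp_assoc.
    rewrite -(comp_assoc _ (_ \om mp m' e3 d)) -tens_idl_comp (mult_frameP m' e3).1.
    by rewrite (linZ (tensm_linr _)) tensm_id compZr compZl comp_idr.
  rewrite -(mx_det_tensl k0 J m e4) -(mx_det_reindex _ swap_bij).
  apply: eq_mx_det => -[c d] [c' d'] /=.
  by rewrite /pr /inr3 /= comp_idr !comp_assoc tens_idl_comp !comp_assoc.
rewrite -El -Er -(assoc_detE m e1 e2 e3 e4) -(assoc_detE m' e1 e2 e3 e4).
rewrite -(mx_det_comp _ _ _ _ (frame_l3 m' e1 e2)) -(mx_det_comp _ _ _ _ (frame_r3 m e3 e4)).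
by apply: eq_mx_det => p q; rewrite comp_idr comp_idl.
Qed.

Lemma assoc_det_cohomologous : n = gdim C ->
  cohomologous (fun f g h => assoc_det m f g h ^+ n) (fun f g h => assoc_det m' f g h ^+ n).
Proof.
(* One exponent n is the one common to all changes of frame in [assoc_det_change], the other is the
   power taken in the cocycle. *)
move=> nD; exists (fun f g => change_det f g ^+ n ^+ n); split=> [f g|f g h].
  by rewrite !expf_neq0 // change_det_neq0.
have := congr1 (fun x => x ^+ n) (assoc_det_change f g h); rewrite -nD /= !exprMn => E.
apply: (mulIf (x := change_det (f * g)%g h ^+ n ^+ n * change_det f g ^+ n ^+ n)).
  by rewrite mulf_neq0 // !expf_neq0 // change_det_neq0.
rewrite E; field.
by rewrite !expf_neq0 // change_det_neq0.
Qed.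

End Comparison.

(** * Transport along a tensor equivalence *)

Section Isos.
Variables (k : fieldType) (C : linCat k).

Definition iso_id (X : C) : iso X X := Iso (comp_idl (idm X)) (comp_idl (idm X)).

Definition iso_sym (X Y : C) (a : iso X Y) : iso Y X := Iso (fwdK a) (bwdK a).

Lemma iso_comp_bwdK (X Y Z : C) (b : iso Y Z) (a : iso X Y) :
  (bwd a \co bwd b) \co (fwd b \co fwd a) = idm X.
Proof. by rewrite !comp_assoc -(comp_assoc _ (bwd b)) bwdK comp_idr bwdK. Qed.

Lemma iso_comp_fwdK (X Y Z : C) (b : iso Y Z) (a : iso X Y) :
  (fwd b \co fwd a) \co (bwd a \co bwd b) = idm Z.
Proof. by rewrite !comp_assoc -(comp_assoc _ (fwd a)) fwdK comp_idr fwdK. Qed.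

Definition iso_comp (X Y Z : C) (b : iso Y Z) (a : iso X Y) : iso X Z :=
  Iso (iso_comp_bwdK b a) (iso_comp_fwdK b a).

End Isos.

Section TensIso.
Variables (k : fieldType) (C : monCat k) (X X' Y Y' : C) (a : iso X X') (b : iso Y Y').

Lemma iso_tens_bwdK : (bwd a \om bwd b) \co (fwd a \om fwd b) = idm (X \ox Y).
Proof. by rewrite -tensm_comp !bwdK tensm_id. Qed.

Lemma iso_tens_fwdK : (fwd a \om fwd b) \co (bwd a \om bwd b) = idm (X' \ox Y').
Proof. by rewrite -tensm_comp !fwdK tensm_id. Qed.

Definition iso_tens : iso (X \ox Y) (X' \ox Y') := Iso iso_tens_bwdK iso_tens_fwdK.

End TensIso.

Section Permutation.

Lemma det_mx_reindex (S : comNzRingType) n (A B : 'M[S]_n) (s : 'S_n) :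
  (forall i j, B (s i) (s j) = A i j) -> \det A = \det B.
Proof.
move=> AB; have -> : A = row_perm s (col_perm s B) by apply/matrixP => i j; rewrite !mxE AB.
rewrite row_permE col_permE !det_mulmx !det_perm odd_permV mulrCA -signr_addb.
by rewrite addbb mulr1.
Qed.

(** The sizes m and n are separate because [nirr C] and [nirr C'] are equal only through the
    bijection of simple objects. *)
Lemma char_poly_reindex (S : comNzRingType) m n (A : 'M[S]_m) (B : 'M[S]_n) (s : 'I_m -> 'I_n) :
  bijective s -> (forall i j, B (s i) (s j) = A i j) -> char_poly A = char_poly B.
Proof.
move=> bs; have mn : m = n by rewrite -(card_ord m) -(card_ord n) (bij_eq_card bs).
subst n => AB; apply: (@det_mx_reindex _ _ _ _ (perm (bij_inj bs))) => i j.
by rewrite !mxE !permE AB (bij_eq bs).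
Qed.

End Permutation.

Section Transport.
Variables (k : closedFieldType) (G : finGroupType) (C C' : gradedFusion k G).
Hypothesis k0 : [pchar k] =i pred0.
Variable F : tensorEquiv C C'.

Definition equiv_functor : linFunctor C C' :=
  LinFunctor (fmap_lin F) (fmap_id F) (fmap_comp F).

Local Notation H := equiv_functor.
Local Notation d x := (fpdim (irr x)).

Lemma fmap_inj (X Y : C) : injective (@fmap _ _ _ F X Y).
Proof. exact: bij_inj (fully_faithful F X Y). Qed.

(** By essential surjectivity and fullness, a subobject of F X is up to isomorphism the image of a
    map into X, and faithfulness makes that map mono. *)
Lemma equiv_simple (X : C) : simple_object X -> simple_object (F X).
Proof.
move=> [nX sX]; split.
  by rewrite /is_zero -fmap_id -(lin0 (@fmap_lin _ _ _ F X X)) => /fmap_inj.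
move=> Y i i_mono; have [Y0 [e]] := ess_surj F Y.
have [r rK Kr] := fully_faithful F Y0 X.
have ij : fmap F (r (i \co e)) = i \co e by exact: Kr.
set j := r (i \co e) in ij.
have j_mono : mono j.
  move=> T a b jab; have := congr1 (@fmap _ _ _ F _ _) jab.
  rewrite !fmap_comp ij -!comp_assoc => /i_mono/(congr1 (comp (bwd e))).
  by rewrite !comp_assoc bwdK !comp_idl => /fmap_inj.
case: (sX _ _ j_mono) => [Y00|[j' [j'j jj']]]; [left|right].
  rewrite /is_zero -(fwdK e) -[fwd e]comp_idr -fmap_id Y00.
  by rewrite (lin0 (@fmap_lin _ _ _ F _ _)) comp0r comp0l.
have iE : i = fmap F j \co bwd e by rewrite ij -comp_assoc fwdK comp_idr.
exists (e \co fmap F j'); split; rewrite iE !comp_assoc.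
  by rewrite -(comp_assoc _ (fmap F j')) -fmap_comp j'j fmap_id comp_idr fwdK.
by rewrite -(comp_assoc _ (bwd e)) bwdK comp_idr -fmap_comp jj' fmap_id.
Qed.

Lemma equiv_irr : exists s : 'I_(nirr C) -> 'I_(nirr C'),
  bijective s /\ forall i, inhabited (iso (F (irr i)) (irr (s i))).
Proof.
have /fin_all_exists[s sP] i := irr_surj (equiv_simple (irr_simple i)).
exists s; split=> //.
have s_inj : injective s.
  move=> i j sij; have [[a] [b]] := (sP i, sP j).
  rewrite sij in a; apply: irr_inj.
  have [r rK Kr] := fully_faithful F (irr i) (irr j).
  have [r' rK' Kr'] := fully_faithful F (irr j) (irr i).
  exists; exists (r (bwd b \co a)) (r' (bwd a \co b)); apply: fmap_inj.
    by rewrite fmap_comp Kr Kr' fmap_id; exact: (iso_comp_bwdK (iso_sym b) a).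
  by rewrite fmap_comp Kr Kr' fmap_id; exact: (iso_comp_bwdK (iso_sym a) b).
(* Write [irr j] as F X: the dimension formula for Hom([irr j], F X), which is a line, forces
   [irr j] to occur in some F([irr i]), and Schur gives s i = j. *)
have s_surj j : exists i, s i = j.
  have [X [e]] := ess_surj F (irr j).
  have := dim_functor H (irr j) X k0; rewrite /= (dim_iso _ k0 e) irr_dim eqxx => E.
  have [i _ ] : exists2 i, true & (0 < \dim {: hom (irr j) (F (irr i))})%N.
    apply/exists_inP; apply: contraPT E => /exists_inPn ni; rewrite big1 // => i _.
    by have := ni i isT; rewrite lt0n negbK => /eqP->; rewrite muln0.
  have [a] := sP i; rewrite (dim_iso _ k0 a) irr_dim; case: eqP => // -> _.
  by exists i.
have [s' s'P] := fin_all_exists s_surj.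
by exists s' => // i; apply: s_inj; rewrite s'P.
Qed.

Section Correspondence.
Variable s : 'I_(nirr C) -> 'I_(nirr C').
Hypotheses (s_bij : bijective s) (sP : forall i, inhabited (iso (F (irr i)) (irr (s i)))).

Lemma equiv_mult (i : 'I_(nirr C)) (X : C) :
  \dim {: hom (irr (s i)) (F X)} = \dim {: hom (irr i) X}.
Proof.
rewrite (dim_functor H (irr (s i)) X k0) (bigD1 i) //= [X in (_ + X)%N]big1 => [|j ji].
  by have [a] := sP i; rewrite (dim_iso _ k0 a) irr_dim eqxx muln1 addn0.
have [a] := sP j; rewrite (dim_iso _ k0 a) irr_dim (bij_eq s_bij) eq_sym (negPf ji).
by rewrite muln0.
Qed.

Lemma equiv_fpdim (x : 'I_(nirr C)) : d (s x) = d x.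
Proof.
rewrite /fpdim /FPdim /eigenvalues; congr (Num.truncn (\big[_/_]_(l <- sval (closed_field_poly_normal _) | _) _)).
symmetry; apply: char_poly_reindex s_bij _ => i j; rewrite !mxE -(equiv_mult j); congr (_%:R).
have [[a] [b]] := (sP x, sP i).
rewrite -(dim_iso _ k0 (iso_tens a b)).
exact: dim_iso (ftens F _ _).
Qed.

Lemma det_aut_equiv (X : C) (f : hom X X) : det_aut (fmap F f) = det_aut f.
Proof.
rewrite -[RHS]expr1; apply: (@det_aut_functor _ _ _ H) => z _ /=.
rewrite (bigD1 (s z)) //= big1 => [|w wz]; have [a] := sP z; rewrite (dim_iso _ k0 a) irr_dim.
  by rewrite eqxx !mul1n addn0 equiv_fpdim.
by rewrite (negPf wz).
Qed.

Hypothesis F_graded : grading_preserving F.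

Let s_deg (i : 'I_(nirr C)) : deg (s i) = deg i.
Proof. exact: F_graded (sP i). Qed.

Lemma equiv_gdim : gdim C' = gdim C.
Proof.
rewrite /gdim (reindex s) /=; last exact: onW_bij.
by apply: eq_big => [i|i _]; rewrite ?s_deg ?equiv_fpdim.
Qed.

Lemma equiv_regular (g : G) : inhabited (iso (F (regular C g)) (regular C' g)).
Proof.
apply: iso_of_mult => j; have [s' _ s'K] := s_bij; rewrite -(s'K j) equiv_mult.
by rewrite !mult_regular // s_deg equiv_fpdim.
Qed.

End Correspondence.

Lemma ftens_natV (X X' Y Y' : C) (f : hom X X') (g : hom Y Y') :
  (fmap F f \om fmap F g) \co bwd (ftens F X Y) = bwd (ftens F X' Y') \co fmap F (f \om g).
Proof.
rewrite -[LHS]comp_idl -(bwdK (ftens F X' Y')) -(comp_assoc (bwd _)) (comp_assoc (fwd _)).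
by rewrite -ftens_nat -comp_assoc fwdK comp_idr.
Qed.

Section Frame.
Variables (phi : forall g, iso (F (regular C g)) (regular C' g)).
Variables (n : nat) (m : mult_frame (regular C) n).
Local Notation R := (regular C).
Local Notation R' := (regular C').

Let phi2 (f g : G) : iso (F (R f \ox R g)) (R' f \ox R' g) :=
  iso_comp (iso_tens (phi f) (phi g)) (iso_sym (ftens F (R f) (R g))).

Definition transport_frame : mult_frame R' n :=
  MultFrame (fun f g x e => frame_iso (phi x) (phi2 f g)
    (frame_functor H (mult_frameP m e))).

(** The isomorphisms [phi u] and [phi w] cancel between successive frames. What is left around the
    associator of C' is the tensor structure of F, whose coherence turns it into the image of the
    associator of C. *)
Lemma transport_assoc_mx (f g h u w x : G) (e1 : (f * g)%g = u) (e2 : (u * h)%g = x)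
  (e3 : (g * h)%g = w) (e4 : (f * w)%g = x) p q :
  assoc_mx transport_frame e1 e2 e3 e4 p q
  = phi x \co fmap F (assoc_mx m e1 e2 e3 e4 p q) \co bwd (phi x).
Proof.
have El : inl3 transport_frame e1 e2 q =
    ((phi f \om phi g) \om phi h) \co (bwd (ftens F (R f) (R g)) \om idm (F (R h)))
      \co bwd (ftens F (R f \ox R g) (R h)) \co fmap F (inl3 m e1 e2 q) \co bwd (phi x).
  rewrite /inl3 /= fmap_comp !comp_assoc; congr (_ \co _ \co _).
  rewrite -(comp_assoc _ (bwd (ftens F (R f \ox R g) (R h)))) -ftens_natV fmap_id.
  rewrite !comp_assoc; congr (_ \co _); rewrite -!tensm_comp !comp_idl ?comp_idr.
  by rewrite -(comp_assoc _ (bwd (phi u))) bwdK comp_idr.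
have Er : prr3 transport_frame e3 e4 p =
    phi x \co fmap F (prr3 m e3 e4 p) \co ftens F (R f) (R g \ox R h)
      \co (idm (F (R f)) \om ftens F (R g) (R h))
      \co (bwd (phi f) \om (bwd (phi g) \om bwd (phi h))).
  rewrite /prr3 /= fmap_comp !comp_assoc -(comp_assoc _ (fmap F (_ \om _))) ftens_nat fmap_id.
  rewrite -!comp_assoc; congr (_ \co (_ \co (_ \co _))).
  rewrite -!tensm_comp ?comp_idl comp_idr !comp_assoc bwdK comp_idl.
  by rewrite ?comp_assoc.
rewrite /assoc_mx El Er.
have E : ftens F (R f) (R g \ox R h) \co (idm (F (R f)) \om ftens F (R g) (R h))
      \co (bwd (phi f) \om (bwd (phi g) \om bwd (phi h))) \co assoc (R' f) (R' g) (R' h)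
      \co ((phi f \om phi g) \om phi h) \co (bwd (ftens F (R f) (R g)) \om idm (F (R h)))
      \co bwd (ftens F (R f \ox R g) (R h)) = fmap F (assoc (R f) (R g) (R h)).
  rewrite -(comp_assoc _ (fwd _)) assoc_nat !comp_assoc -(comp_assoc _ (bwd (phi f) \om _)).
  rewrite -!tensm_comp !bwdK !tensm_id comp_idr -ftens_assoc.
  rewrite -(comp_assoc _ (ftens F (R f) (R g) \om _)) -tensm_comp fwdK comp_idl tensm_id comp_idr.
  by rewrite -comp_assoc fwdK comp_idr.
by rewrite !fmap_comp -E !comp_assoc.
Qed.

Lemma transport_assoc_det (f g h : G) :
  (exists s : 'I_(nirr C) -> 'I_(nirr C'),
    bijective s /\ forall i, inhabited (iso (F (irr i)) (irr (s i)))) ->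
  assoc_det transport_frame f g h = assoc_det m f g h.
Proof.
move=> [s [s_bij sP]]; rewrite /assoc_det [RHS]/mx_det -(det_aut_equiv s_bij sP).
set x := (f * g * h)%g.
pose S := copies ('I_n * 'I_n)%type (R x).
have Fr := frame_iso (phi x) (iso_id (F S)) (frame_functor H (frame_dirsum S)).
rewrite (det_aut_frame _ Fr); apply: eq_mx_det => p q.
rewrite transport_assoc_mx -(mx_homK (assoc_mx m _ _ _ _)) !fmap_comp /=.
by rewrite comp_idr comp_idl !comp_assoc.
Qed.

End Frame.
End Transport.

Theorem proposition4p3 (k : closedFieldType) (hk : [pchar k] =i pred0)
    (G : finGroupType) (C : gradedFusion k G) (hC : integral C)
    (J : regular_mul C) :
  is_3cocycle (alphaC J) /\
  forall (C' : gradedFusion k G) (J' : regular_mul C') (F : tensorEquiv C C'),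
    grading_preserving F -> cohomologous (alphaC J) (alphaC J').
Proof.
split.
  have [nz co] := assoc_det_cocycle hk J (regular_frame J) erefl.
  by split=> [f g h|f g h l]; rewrite !alphaCE.
move=> C' J' F F_graded; have E := equiv_irr hk F; have [s [s_bij sP]] := E.
(* Each isomorphism is only known to exist; finiteness of G gives a simultaneous choice. *)
have [phi] : inhabited (forall g, iso (F (regular C g)) (regular C' g)).
  have /fin_all_exists[phi _] : forall g, exists a : iso (F (regular C g)) (regular C' g), True.
    by move=> g; have [a] := equiv_regular hk s_bij sP F_graded g; exists a.
  by exists.
pose m := transport_frame phi (regular_frame J).
have mE f g h : alphaC J f g h = assoc_det m f g h ^+ gdim C.
  by rewrite alphaCE transport_assoc_det.
(* Forgetting how [m] was built, and keeping only [mE], allows its size [gdim C] to be rewritten as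
   [gdim C'], the size of the frame of [J']. *)
move: m mE; rewrite -(equiv_gdim hk s_bij sP F_graded) => m mE.
have [b [b0 bE]] := assoc_det_cohomologous hk J' m (regular_frame J') erefl.
by exists b; split=> // f g h; rewrite alphaCE mE.
Qed.
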